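(* Let $(R,\mathfrak m)$ be a complete Noetherian local Cohen-Macaulay ring of dimension $n$. Suppose that $\mathfrak p\in\operatorname{Spec}(R)$ with $\dim(R/\mathfrak p)=1$. Then there is an isomorphism \[ D(E_R(R/\mathfrak p))\cong \hat{R}_{\mathfrak p}. \]
   Context: $k=R/\mathfrak m$ is the residue field. For an $R$-module $N$, $E_R(N)$ denotes an injective hull of $N$ over $R$, and $D(\cdot)=\operatorname{Hom}_R(\cdot,E_R(k))$ is the Matlis dual functor. $\hat{R}_{\mathfrak p}$ denotes the completion of the localization $R_{\mathfrak p}$ with respect to its maximal ideal $\mathfrak pR_{\mathfrak p}$. ''Complete'' means complete in the $\mathfrak m$-adic topology. The isomorphism is one of $R$-modules. *)

(* Defs.v *)
From HB Require Import structures.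
From mathcomp Require Import all_boot all_algebra.
From mathcomp Require Import generic_quotient ring_quotient.
From mathcomp Require Import boolp ring.

Set Implicit Arguments.
Unset Strict Implicit.
Unset Printing Implicit Defensive.

Import GRing.Theory.

Local Open Scope ring_scope.
Local Open Scope quotient_scope.

(* Ideals of a commutative ring [A] are the proper ideals [idealr A] of
   [ring_quotient]; as [{pred A}] is [A -> bool], ideals given by a proposition
   are cut out with [asbool], so that [idealr A] ranges over all proper ideals. *)

Section Rings.
Variable A : comNzRingType.

Definition seq_ideal (s : seq A) : {pred A} :=
  fun x => `[< exists c : nat -> A, x = \sum_(i < size s) c i * s`_i >].

(* The unit ideal, which is not an [idealr], is generated by 1. *)
Definition noetherian :=
  forall I : idealr A, exists s : seq A, (I : {pred A}) =i seq_ideal s.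

Definition maximal_ideal (I : idealr A) :=
  forall J : idealr A, {subset I <= J} -> {subset J <= I}.

Definition local_ring (m : idealr A) :=
  maximal_ideal m /\
  forall J : idealr A, maximal_ideal J -> (J : {pred A}) =i (m : {pred A}).

Definition prime_chain (l : nat) (P : 'I_l.+1 -> prime_idealr A) :=
  forall i j : 'I_l.+1, (i < j)%N ->
    {subset P i <= P j} /\ ~ {subset P j <= P i}.

Definition krull_dim (d : nat) :=
  (exists P : 'I_d.+1 -> prime_idealr A, prime_chain P) /\
  forall l (P : 'I_l.+1 -> prime_idealr A), prime_chain P -> (l <= d)%N.

Definition regular_seq (s : seq A) :=
  1 \notin seq_ideal s /\
  forall i, (i < size s)%N -> forall a : A,
    a * s`_i \in seq_ideal (take i s) -> a \in seq_ideal (take i s).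

Definition depth (m : idealr A) (d : nat) :=
  (exists s : seq A,
     [/\ {subset s <= m}, regular_seq s & size s = d]) /\
  forall s : seq A, {subset s <= m} -> regular_seq s -> (size s <= d)%N.

(* For a Noetherian local ring [A] with maximal ideal [m]. *)
Definition cohen_macaulay (m : idealr A) :=
  exists d, krull_dim d /\ depth m d.

End Rings.

Section IdealPower.
Variables (A : comNzRingType) (I : idealr A).

Definition ideal_exp (n : nat) : {pred A} :=
  fun x => `[< exists k (a : 'I_k -> 'I_n -> A),
                 (forall i j, a i j \in I) /\ x = \sum_i \prod_j a i j >].

Lemma ideal_expS_sub n : {subset ideal_exp n.+1 <= I}.
Proof.
move=> x /asboolP[k [a [aI ->]]]; apply: rpred_sum => i _.
by rewrite big_ord_recl mulrC idealMr.
Qed.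

Lemma ideal_expS_closed n : idealr_closed (ideal_exp n.+1).
Proof.
split.
- by apply/asboolP; exists 0%N, (fun _ _ => 0); split=> [[]//|]; rewrite big_ord0.
- by apply/negP => /ideal_expS_sub; rewrite idealr1.
- move=> b u v /asboolP[k [a [aI ->]]] /asboolP[l [c [cI ->]]]; apply/asboolP.
  exists (k + l)%N, (fun i j => match split i with
    | inl i' => if j == ord0 then b * a i' j else a i' j
    | inr i' => c i' j end).
  split=> [i j|].
    case: (split i) => i'; last exact: cI.
    by case: ifP => _; [apply: idealMr|]; exact: aI.
  rewrite big_split_ord mulr_sumr; congr (_ + _); apply: eq_bigr => i _ /=.
    under [RHS]eq_bigr do rewrite (unsplitK (inl i)).
    by rewrite !big_ord_recl eqxx mulrA.
  by apply: eq_bigr => j _; rewrite (unsplitK (inr i)).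
Qed.

HB.instance Definition _ n := isIdealr.Build A (ideal_exp n.+1) (ideal_expS_closed n).

End IdealPower.

(* The [I]-adic completion is the limit of the rings A/I^n over n >= 1. *)
Section Completion.
Variables (A : comNzRingType) (I : idealr A).

Definition adic_prod := forall n : nat, {ideal_quot (ideal_exp I n.+1)}.

HB.instance Definition _ := Choice.on adic_prod.

Implicit Types x y z : adic_prod.

Let add x y : adic_prod := fun n => x n + y n.
Let opp x : adic_prod := fun n => - x n.
Let zero : adic_prod := fun n => 0.
Let mul x y : adic_prod := fun n => x n * y n.
Let one : adic_prod := fun n => 1.

Fact adic_addA : associative add.
Proof. by move=> x y z; apply: functional_extensionality_dep => n; exact: addrA. Qed.
Fact adic_addC : commutative add.
Proof. by move=> x y; apply: functional_extensionality_dep => n; exact: addrC. Qed.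
Fact adic_add0 : left_id zero add.
Proof. by move=> x; apply: functional_extensionality_dep => n; exact: add0r. Qed.
Fact adic_addN : left_inverse zero opp add.
Proof. by move=> x; apply: functional_extensionality_dep => n; exact: addNr. Qed.

HB.instance Definition _ :=
  GRing.isZmodule.Build adic_prod adic_addA adic_addC adic_add0 adic_addN.

Fact adic_mulA : associative mul.
Proof. by move=> x y z; apply: functional_extensionality_dep => n; exact: mulrA. Qed.
Fact adic_mulC : commutative mul.
Proof. by move=> x y; apply: functional_extensionality_dep => n; exact: mulrC. Qed.
Fact adic_mul1 : left_id one mul.
Proof. by move=> x; apply: functional_extensionality_dep => n; exact: mul1r. Qed.
Fact adic_mulD : left_distributive mul +%R.
Proof. by move=> x y z; apply: functional_extensionality_dep => n; exact: mulrDl. Qed.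
Fact adic_one_neq0 : one != 0.
Proof.
apply/eqP => /(congr1 (fun x : adic_prod => x 0%N)) /eqP.
by rewrite /one (negPf (oner_neq0 _)).
Qed.

HB.instance Definition _ := GRing.Zmodule_isComNzRing.Build adic_prod
  adic_mulA adic_mulC adic_mul1 adic_mulD adic_one_neq0.

(* The component in A/I^(n+2) maps to the component in A/I^(n+1). *)
Definition adic_compat : {pred adic_prod} :=
  fun x => `[< forall n, exists a : A, x n = \pi a /\ x n.+1 = \pi a >].

Fact adic_compat_closed : subring_closed adic_compat.
Proof.
split.
- by apply/asboolP => n; exists 1; rewrite !rmorph1.
- move=> x y /asboolP hx /asboolP hy; apply/asboolP => n.
  have [[a [xa xa']] [b [yb yb']]] := (hx n, hy n); exists (a - b).
  split; rewrite rmorphB.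
    by transitivity (x n - y n); rewrite // xa yb.
  by transitivity (x n.+1 - y n.+1); rewrite // xa' yb'.
- move=> x y /asboolP hx /asboolP hy; apply/asboolP => n.
  have [[a [xa xa']] [b [yb yb']]] := (hx n, hy n); exists (a * b).
  split; rewrite rmorphM.
    by transitivity (x n * y n); rewrite // xa yb.
  by transitivity (x n.+1 * y n.+1); rewrite // xa' yb'.
Qed.

HB.instance Definition _ :=
  GRing.isSubringClosed.Build adic_prod adic_compat adic_compat_closed.

Definition adic_completion := {x : adic_prod | x \in adic_compat}.

HB.instance Definition _ := SubChoice.on adic_completion.
HB.instance Definition _ :=
  [SubChoice_isSubComNzRing of adic_completion by <:].

Fact to_adic_compat (a : A) : ((fun n => \pi a) : adic_prod) \in adic_compat.
Proof. by apply/asboolP => n; exists a. Qed.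

Definition to_completion (a : A) : adic_completion := exist (fun x => x \in adic_compat) _ (to_adic_compat a).

Fact to_completion_zmod_morphism : zmod_morphism to_completion.
Proof.
move=> a b; apply/val_inj; apply: functional_extensionality_dep => n.
exact: rmorphB.
Qed.

Fact to_completion_monoid_morphism : monoid_morphism to_completion.
Proof.
split=> [|a b]; apply/val_inj; apply: functional_extensionality_dep => n.
  exact: rmorph1.
exact: rmorphM.
Qed.

HB.instance Definition _ := GRing.isZmodMorphism.Build A adic_completion
  to_completion to_completion_zmod_morphism.
HB.instance Definition _ := GRing.isMonoidMorphism.Build A adic_completion
  to_completion to_completion_monoid_morphism.

Definition adic_complete := bijective to_completion.

End Completion.

Section Localization.
Variables (A : comNzRingType) (p : prime_idealr A).

Definition fraction := {x : A * A | x.2 \notin p}.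

Implicit Types x y z : fraction.

Definition frac_num x : A := (val x).1.
Definition frac_den x : A := (val x).2.

Definition mkfrac (a s : A) (sp : s \notin p) : fraction :=
  exist (fun x : A * A => x.2 \notin p) (a, s) sp.

Fact den_notin x : frac_den x \notin p. Proof. exact: (valP x). Qed.

Fact notin_mul s t : s \notin p -> t \notin p -> s * t \notin p.
Proof. by move=> sp tp; rewrite prime_idealrM negb_or sp. Qed.

Fact notin_one : 1 \notin p. Proof. by rewrite idealr1. Qed.

Definition frac_equiv x y :=
  `[< exists2 u, u \notin p &
        u * (frac_num x * frac_den y) = u * (frac_num y * frac_den x) >].

Fact frac_equiv_refl : reflexive frac_equiv.
Proof. by move=> x; apply/asboolP; exists 1; rewrite ?notin_one. Qed.

Fact frac_equiv_sym : symmetric frac_equiv.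
Proof. by move=> x y; apply/asboolP/asboolP => -[u up e]; exists u. Qed.

Fact frac_equiv_trans : transitive frac_equiv.
Proof.
move=> y x z /asboolP[u up xy] /asboolP[v vp yz]; apply/asboolP.
exists (u * v * frac_den y); first by rewrite !notin_mul ?den_notin.
transitivity (v * frac_den z * (u * (frac_num x * frac_den y))); first by ring.
rewrite xy; transitivity (u * frac_den x * (v * (frac_num y * frac_den z))); first by ring.
by rewrite yz; ring.
Qed.

Canonical frac_equiv_rel :=
  EquivRel frac_equiv frac_equiv_refl frac_equiv_sym frac_equiv_trans.

Definition localization := {eq_quot frac_equiv}.

HB.instance Definition _ : EqQuotient _ frac_equiv localization :=
  EqQuotient.on localization.
HB.instance Definition _ := Choice.on localization.

Definition loc_frac (a s : A) (sp : s \notin p) : localization :=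
  \pi_localization (mkfrac a sp).

Fact loc_fracP (x : localization) :
  exists a s (sp : s \notin p), x = loc_frac a sp.
Proof.
elim/quotW: x => -[[a s] sp]; exists a, s, sp.
by congr (\pi_localization _); apply/val_inj.
Qed.

Fact loc_frac_eqP a s (sp : s \notin p) b t (tp : t \notin p) :
  loc_frac a sp = loc_frac b tp <->
  exists2 u, u \notin p & u * (a * t) = u * (b * s).
Proof.
rewrite /loc_frac; split=> [/eqmodP/asboolP//|h].
by apply/eqmodP/asboolP.
Qed.

Let addf x y : fraction := mkfrac (frac_num x * frac_den y + frac_num y * frac_den x)
  (notin_mul (den_notin x) (den_notin y)).
Let oppf x : fraction := mkfrac (- frac_num x) (den_notin x).
Let mulf x y : fraction := mkfrac (frac_num x * frac_num y)
  (notin_mul (den_notin x) (den_notin y)).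

Definition loc_add (x y : localization) : localization :=
  \pi_localization (addf (repr x) (repr y)).
Definition loc_opp (x : localization) : localization := \pi_localization (oppf (repr x)).
Definition loc_mul (x y : localization) : localization :=
  \pi_localization (mulf (repr x) (repr y)).

Fact repr_loc_frac a s (sp : s \notin p) :
  exists2 u, u \notin p &
    u * (frac_num (repr (loc_frac a sp)) * s) = u * (a * frac_den (repr (loc_frac a sp))).
Proof.
have /eqmodP/asboolP : repr (loc_frac a sp) = mkfrac a sp %[mod localization].
  by rewrite reprK.
by [].
Qed.

Fact loc_addE a s (sp : s \notin p) b t (tp : t \notin p) :
  loc_add (loc_frac a sp) (loc_frac b tp) =
  loc_frac (a * t + b * s) (notin_mul sp tp).
Proof.
have [u up hu] := repr_loc_frac a sp; have [v vp hv] := repr_loc_frac b tp.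
move: hu hv; rewrite /loc_add; set x := repr _; set y := repr _ => hu hv.
apply/loc_frac_eqP; exists (u * v); first exact: notin_mul.
transitivity (v * frac_den y * t * (u * (frac_num x * s)) +
              u * frac_den x * s * (v * (frac_num y * t))); first by ring.
by rewrite hu hv; ring.
Qed.

Fact loc_oppE a s (sp : s \notin p) : loc_opp (loc_frac a sp) = loc_frac (- a) sp.
Proof.
have [u up hu] := repr_loc_frac a sp.
by apply/loc_frac_eqP; exists u => //; rewrite !mulNr !mulrN hu.
Qed.

Fact loc_mulE a s (sp : s \notin p) b t (tp : t \notin p) :
  loc_mul (loc_frac a sp) (loc_frac b tp) =
  loc_frac (a * b) (notin_mul sp tp).
Proof.
have [u up hu] := repr_loc_frac a sp; have [v vp hv] := repr_loc_frac b tp.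
move: hu hv; rewrite /loc_mul; set x := repr _; set y := repr _ => hu hv.
apply/loc_frac_eqP; exists (u * v); first exact: notin_mul.
transitivity ((u * (frac_num x * s)) * (v * (frac_num y * t))); first by ring.
by rewrite hu hv; ring.
Qed.

Let loc_eq a s (sp : s \notin p) b t (tp : t \notin p) :
  a * t = b * s -> loc_frac a sp = loc_frac b tp.
Proof. by move=> e; apply/loc_frac_eqP; exists 1; rewrite ?notin_one ?e. Qed.

Definition to_loc (a : A) : localization := loc_frac a notin_one.

Fact loc_addA : associative loc_add.
Proof.
move=> x y z; have [[a [s [sp ->]]] [b [t [tp ->]]]] := (loc_fracP x, loc_fracP y).
have [c [v [vp ->]]] := loc_fracP z; rewrite !loc_addE; apply: loc_eq; ring.
Qed.
Fact loc_addC : commutative loc_add.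
Proof.
move=> x y; have [[a [s [sp ->]]] [b [t [tp ->]]]] := (loc_fracP x, loc_fracP y).
rewrite !loc_addE; apply: loc_eq; ring.
Qed.
Fact loc_add0 : left_id (to_loc 0) loc_add.
Proof.
move=> x; have [a [s [sp ->]]] := loc_fracP x.
rewrite /to_loc loc_addE; apply: loc_eq; ring.
Qed.
Fact loc_addN : left_inverse (to_loc 0) loc_opp loc_add.
Proof.
move=> x; have [a [s [sp ->]]] := loc_fracP x.
rewrite /to_loc loc_oppE loc_addE; apply: loc_eq; ring.
Qed.

HB.instance Definition _ :=
  GRing.isZmodule.Build localization loc_addA loc_addC loc_add0 loc_addN.

Fact loc_mulA : associative loc_mul.
Proof.
move=> x y z; have [[a [s [sp ->]]] [b [t [tp ->]]]] := (loc_fracP x, loc_fracP y).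
have [c [v [vp ->]]] := loc_fracP z; rewrite !loc_mulE; apply: loc_eq; ring.
Qed.
Fact loc_mulC : commutative loc_mul.
Proof.
move=> x y; have [[a [s [sp ->]]] [b [t [tp ->]]]] := (loc_fracP x, loc_fracP y).
rewrite !loc_mulE; apply: loc_eq; ring.
Qed.
Fact loc_mul1 : left_id (to_loc 1) loc_mul.
Proof.
move=> x; have [a [s [sp ->]]] := loc_fracP x.
rewrite /to_loc loc_mulE; apply: loc_eq; ring.
Qed.
Fact loc_mulD : left_distributive loc_mul loc_add.
Proof.
move=> x y z; have [[a [s [sp ->]]] [b [t [tp ->]]]] := (loc_fracP x, loc_fracP y).
have [c [v [vp ->]]] := loc_fracP z.
rewrite !(loc_addE, loc_mulE); apply: loc_eq; ring.
Qed.
Fact loc_one_neq0 : to_loc 1 != 0.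
Proof.
apply/eqP => /loc_frac_eqP[u up]; rewrite !mulr1 mulr0 => u0.
by rewrite u0 idealr0 in up.
Qed.

HB.instance Definition _ := GRing.Zmodule_isComNzRing.Build localization
  loc_mulA loc_mulC loc_mul1 loc_mulD loc_one_neq0.

Fact to_loc_zmod_morphism : zmod_morphism to_loc.
Proof.
move=> a b; change (to_loc (a - b) = loc_add (to_loc a) (loc_opp (to_loc b))).
rewrite /to_loc loc_oppE loc_addE; apply: loc_eq; ring.
Qed.

Fact to_loc_monoid_morphism : monoid_morphism to_loc.
Proof.
split=> // a b; change (to_loc (a * b) = loc_mul (to_loc a) (to_loc b)).
rewrite /to_loc loc_mulE; apply: loc_eq; ring.
Qed.

HB.instance Definition _ := GRing.isZmodMorphism.Build A localization
  to_loc to_loc_zmod_morphism.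
HB.instance Definition _ := GRing.isMonoidMorphism.Build A localization
  to_loc to_loc_monoid_morphism.

(* The ideal pA_p. *)
Definition loc_max : {pred localization} :=
  fun q => `[< exists a s (sp : s \notin p), a \in p /\ q = loc_frac a sp >].

Fact loc_max_closed : idealr_closed loc_max.
Proof.
split.
- by apply/asboolP; exists 0, 1, notin_one; rewrite idealr0.
- apply/negP => /asboolP[a [s [sp [ap /loc_frac_eqP[u up]]]]].
  rewrite mul1r mulr1 => e; have := notin_mul up sp.
  by rewrite e idealMr.
- move=> w _ _ /asboolP[b [t [tp [bp ->]]]] /asboolP[c [v [vp [cp ->]]]].
  have [a [s [sp ->]]] := loc_fracP w; apply/asboolP.
  exists (a * b * v + c * (s * t)), (s * t * v), (notin_mul (notin_mul sp tp) vp).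
  split; last by rewrite -loc_addE -loc_mulE.
  by apply: rpredD; rewrite mulrC; do !apply: idealMr.
Qed.

HB.instance Definition _ := isIdealr.Build localization loc_max loc_max_closed.

Definition loc_completion := adic_completion loc_max.

HB.instance Definition _ := GRing.ComNzRing.on loc_completion.

Definition to_loc_completion : A -> loc_completion :=
  @to_completion localization loc_max \o to_loc.

HB.instance Definition _ := GRing.RMorphism.on to_loc_completion.

End Localization.

(* [S] as an [R]-module, through the ring morphism [phi]. *)
Definition restrict_scalars (R S : comNzRingType) (phi : {rmorphism R -> S}) :
  Type := S.

Section RestrictScalars.
Variables (R S : comNzRingType) (phi : {rmorphism R -> S}).
Local Notation M := (restrict_scalars phi).

HB.instance Definition _ := GRing.Zmodule.copy M S.

Let scale (a : R) (x : M) : M := phi a * (x : S).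

Fact restrict_scaleA a b x : scale a (scale b x) = scale (a * b) x.
Proof. by rewrite /scale rmorphM mulrA. Qed.
Fact restrict_scale1 : left_id 1 scale.
Proof. by move=> x; rewrite /scale rmorph1 mul1r. Qed.
Fact restrict_scaleDr : right_distributive scale +%R.
Proof. by move=> a x y; exact: mulrDr. Qed.
Fact restrict_scaleDl (x : M) : {morph scale^~ x : a b / a + b}.
Proof. by move=> a b; rewrite /scale rmorphD; exact: mulrDl. Qed.

HB.instance Definition _ := GRing.Zmodule_isLmodule.Build R M
  restrict_scaleA restrict_scale1 restrict_scaleDr restrict_scaleDl.

End RestrictScalars.

Section Quotient.
Variables (R : comNzRingType) (I : idealr R).

Definition quot_pi : {rmorphism R -> {ideal_quot I}} := \pi.
Definition quot_module : lmodType R := restrict_scalars quot_pi.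

End Quotient.

Section Modules.
Variable R : comNzRingType.

Definition injective_module (E : lmodType R) :=
  forall (M N : lmodType R) (i : {linear M -> N}) (f : {linear M -> E}),
    injective i -> exists g : {linear N -> E}, forall x, g (i x) = f x.

Definition essential_mono (N E : lmodType R) (i : {linear N -> E}) :=
  injective i /\
  forall U : submodClosed E, (exists2 x, x \in U & x != 0) ->
    exists2 y, i y \in U & i y != 0.

Definition injective_hull (N E : lmodType R) :=
  injective_module E /\ exists i : {linear N -> E}, essential_mono i.

End Modules.

Section Hom.
Variables (R : comNzRingType) (M N : lmodType R).

Definition linear_hom : Type := {linear M -> N}.

HB.instance Definition _ := gen_eqMixin linear_hom.
HB.instance Definition _ := gen_choiceMixin linear_hom.

Implicit Types f g h : linear_hom.

Fact hom_ext f g : f =1 g -> f = g.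
Proof.
case: f g => [f [[fA] [fZ]]] [g [[gA] [gZ]]] /= fg.
have {fg} e : f = g by apply: funext.
rewrite {}e in fA fZ *.
by rewrite (Prop_irrelevance fA gA) (Prop_irrelevance fZ gZ).
Qed.

Let add f g : linear_hom := f \+ g.
Let opp f : linear_hom := \- f.
Let zero : linear_hom := \0.
Let scale (a : R) f : linear_hom := a \*: f.

Fact hom_addA : associative add.
Proof. by move=> f g h; apply: hom_ext => x; exact: addrA. Qed.
Fact hom_addC : commutative add.
Proof. by move=> f g; apply: hom_ext => x; exact: addrC. Qed.
Fact hom_add0 : left_id zero add.
Proof. by move=> f; apply: hom_ext => x; exact: add0r. Qed.
Fact hom_addN : left_inverse zero opp add.
Proof. by move=> f; apply: hom_ext => x; exact: addNr. Qed.

HB.instance Definition _ :=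
  GRing.isZmodule.Build linear_hom hom_addA hom_addC hom_add0 hom_addN.

Fact hom_scaleA a b f : scale a (scale b f) = scale (a * b) f.
Proof. by apply: hom_ext => x; exact: scalerA. Qed.
Fact hom_scale1 : left_id 1 scale.
Proof. by move=> f; apply: hom_ext => x; exact: scale1r. Qed.
Fact hom_scaleDr : right_distributive scale +%R.
Proof. by move=> a f g; apply: hom_ext => x; exact: scalerDr. Qed.
Fact hom_scaleDl f : {morph scale^~ f : a b / a + b}.
Proof. by move=> a b; apply: hom_ext => x; exact: scalerDl. Qed.

HB.instance Definition _ := GRing.Zmodule_isLmodule.Build R linear_hom
  hom_scaleA hom_scale1 hom_scaleDr hom_scaleDl.

End Hom.

(* The Matlis dual of [M], for [Ek] an injective hull of the residue field. *)
Definition matlis_dual (R : comNzRingType) (Ek M : lmodType R) : lmodType R :=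
  linear_hom M Ek.

(* Main.v *)
Require Import Defs.
From HB Require Import structures.
From mathcomp Require Import all_boot all_algebra.
From mathcomp Require Import generic_quotient ring_quotient.
From mathcomp Require Import boolp ring.

Set Implicit Arguments.
Unset Strict Implicit.
Unset Printing Implicit Defensive.

Import GRing.Theory.

Local Open Scope ring_scope.
Local Open Scope quotient_scope.


(** Let [e1] be the image of 1 in [Ep] and [k1] the image of 1 in [Ek].  As [p]
    is contained in [m], sending [e1] to [k1] defines a map on [R e1], and by
    injectivity of [Ek] it extends to a linear map [phi : Ep -> Ek].  The theorem
    holds because every linear map [Ep -> Ek] is [phi] preceded by the action of
    a unique element of the completion of [R_p]; a suitable [phi] turns the
    Matlis dual of [Ep] into the endomorphism ring of [Ep], which by Matlis is
    that completion.

    Elements outside [p] act bijectively on [Ep], and [Ep] is the union of the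
    submodules [E_n] killed by [p^(n+1)], so the completion acts on [Ep].  The
    multiplier of a map is found on the [E_n] one after the other
    ([multiplier_exists]): a map vanishing on [E_n] depends, on [E_(n+1)], only
    on the products [c e] with [c] among the generators of [p^(n+1)], and these
    lie in the socle [E_0], so everything comes down to [E_0].  Uniqueness
    ([multiplier_faithful]) holds because a nonzero submodule of [Ep] stable
    under [R_p] contains [E_0], on which [phi] is not zero, and because an
    element of [R] killing [E_n] lies in [p^(n+1) R_p].

    What remains ([socle_multiplier]) is that [Hom(E_0, Ek)], where [E_0] is a
    copy of [Frac(R/p)], has dimension at most one over [Frac(R/p)]; in the
    language of duality, that the canonical module of [R/p] has rank one.  This is where completeness and
    [dim(R/p) = 1] enter.  The method of the previous paragraph, applied to [m]
    in place of [p] and to the identity of [Ek], shows that endomorphisms of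
    [Ek] are multiplications by elements of [R] ([residue_hull_endo]).  Take [x]
    in [m] but not in [p], so that [E_0] is the union of the [R u_n] with
    [x^n u_n = e1].  Double annihilators show that [phi] maps [E_0] onto the
    part of [Ek] killed by [p] ([hull_map_socle_onto]).  The part killed by [p]
    and [x] satisfies the ascending chain condition, so it lies in a single
    [R phi(u_N)], and therefore [phi(a u_N) = 0] forces [a] into [x R + p]
    ([annihilator_u_sub]).  By descent on powers of [x] the kernel of [phi] on
    [E_0] is then a bounded fractional ideal: [x^N] sends it into [R e1]
    ([kernel_bounded]).  Given another map [psi], some power of [x] kills
    [psi e1], so some [x^L psi] vanishes on this kernel and factors as
    [g o phi] with [g] an endomorphism of [Ek], that is, a multiplication. *)

(** * Ideals as propositional predicates *)

Section Ideals.
Variable R : comNzRingType.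

(** The unit ideal satisfies this predicate, so sums of ideals can be formed
    without a check of properness. *)
Definition is_ideal (P : R -> Prop) :=
  P 0 /\ forall a x y, P x -> P y -> P (a * x + y).

Lemma is_idealD P x y : is_ideal P -> P x -> P y -> P (x + y).
Proof. by move=> [_ PD] Px Py; rewrite -[x]mul1r; exact: PD. Qed.

Lemma is_idealM P a x : is_ideal P -> P x -> P (a * x).
Proof. by move=> [P0 PD] Px; rewrite -[_ * _]addr0; exact: PD. Qed.

Lemma idealr_is_ideal (I : idealr R) : is_ideal (fun x => x \in I).
Proof.
by split=> [|a x y xI yI]; [exact: idealr0|rewrite rpredD ?idealMr].
Qed.

Lemma idealr_of (P : R -> Prop) : is_ideal P -> ~ P 1 ->
  exists I : idealr R, forall x, (x \in I) = `[< P x >].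
Proof.
move=> [P0 PD] P1; pose S : {pred R} := fun x => `[< P x >].
have SI : idealr_closed S.
  split; [exact/asboolP|exact/asboolP|].
  by move=> a x y /asboolP Px /asboolP Py; apply/asboolP; exact: PD.
by exists (HB.pack_for (idealr R) S (isIdealr.Build R S SI)).
Qed.

Lemma prime_idealr_of (P : R -> Prop) : is_ideal P -> ~ P 1 ->
    (forall a b, P (a * b) -> P a \/ P b) ->
  exists I : prime_idealr R, forall x, (x \in I) = `[< P x >].
Proof.
move=> PI P1 PM; have [I IP] := idealr_of PI P1.
have Iprime : prime_idealr_closed (I : {pred R}).
  move=> a b; rewrite !IP => /asboolP/PM[]/asboolP ->//; exact: orbT.
by exists (HB.pack_for (prime_idealr R) (Idealr.sort I)
  (isPrimeIdealrClosed.Build R (Idealr.sort I) Iprime)).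
Qed.

Lemma ideal_exp1 (I : idealr R) x : (x \in ideal_exp I 1) = (x \in I).
Proof.
apply/idP/idP => [/ideal_expS_sub//|xI]; apply/asboolP.
by exists 1%N, (fun _ _ => x); rewrite !big_ord1.
Qed.

Lemma ideal_exp_prod (I : idealr R) n (a : 'I_n -> R) :
  (forall j, a j \in I) -> \prod_j a j \in ideal_exp I n.
Proof.
by move=> aI; apply/asboolP; exists 1%N, (fun _ => a); rewrite big_ord1.
Qed.

Lemma ideal_exp_mul (I : idealr R) k n x y :
  x \in ideal_exp I k.+1 -> y \in ideal_exp I n.+1 ->
  x * y \in ideal_exp I (k.+1 + n.+1).
Proof.
move=> /asboolP[i [a [aI ->]]] /asboolP[j [b [bI ->]]].
(* [rpred_sum] needs the exponent in the form of a successor. *)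
change ((\sum_i0 \prod_j a i0 j) * (\sum_i0 \prod_j b i0 j)
  \in ideal_exp I (k + n.+1).+1).
rewrite mulr_suml; apply: rpred_sum => i' _.
rewrite mulr_sumr; apply: rpred_sum => j' _.
change ((\prod_j a i' j) * \prod_j b j' j \in ideal_exp I (k.+1 + n.+1)).
apply/asboolP; exists 1%N, (fun _ l => match split l with
  | inl l => a i' l | inr l => b j' l end).
split=> [_ l|]; first by case: (split l) => l'; [exact: aI|exact: bI].
rewrite big_ord1 big_split_ord; congr (_ * _); apply: eq_bigr => l _.
  by rewrite (unsplitK (inl l)).
by rewrite (unsplitK (inr l)).
Qed.

Lemma ideal_exp_ind (I : idealr R) k n (Q : R -> Prop) : is_ideal Q ->
    (forall x y, x \in ideal_exp I k -> y \in ideal_exp I n -> Q (x * y)) ->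
  forall z, z \in ideal_exp I (k + n) -> Q z.
Proof.
move=> QI Qxy z /asboolP[i [a [aI ->]]].
elim/big_ind: _ => [|x y|j _]; [by case: QI|exact: is_idealD|].
by rewrite big_split_ord; apply: Qxy; apply: ideal_exp_prod.
Qed.

Lemma ideal_expS_le (I : idealr R) n : {subset ideal_exp I n.+2 <= ideal_exp I n.+1}.
Proof.
move=> z; apply: (@ideal_exp_ind I 1 n.+1 (fun z => z \in ideal_exp I n.+1)).
  exact: idealr_is_ideal.
by move=> x y _ yI; exact: idealMr.
Qed.

Lemma ideal_exp_le (I : idealr R) k n : (k <= n)%N ->
  {subset ideal_exp I n.+1 <= ideal_exp I k.+1}.
Proof.
move=> /subnK <-; elim: (n - k)%N => // l IHl x; rewrite addSn.
by move=> /ideal_expS_le /IHl.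
Qed.

Hypothesis R_noeth : noetherian R.

(** Generation is stated through its universal property, which is how it is
    used: a property defining an ideal need only be checked on generators. *)
Lemma ideal_generators (P : R -> Prop) : is_ideal P -> exists s : seq R,
  (forall c, c \in s -> P c) /\
  forall Q, is_ideal Q -> (forall c, c \in s -> Q c) -> forall x, P x -> Q x.
Proof.
move=> PI; have [P1|P1] := pselect (P 1).
  exists [:: 1]; split=> [c|Q QI Qs x _]; first by rewrite inE => /eqP ->.
  by rewrite -[x]mulr1; apply: is_idealM => //; apply: Qs; rewrite inE.
have [I IP] := idealr_of PI P1; have [s Is] := R_noeth I.
exists s; split=> [c cs|Q QI Qs x Px].
  apply/asboolP; rewrite -IP Is; apply/asboolP.
  exists (fun i => (i == index c s)%:R).
  have cs' : (index c s < size s)%N by rewrite index_mem.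
  rewrite (bigD1 (Ordinal cs')) //= eqxx mul1r nth_index// big1 ?addr0// => i.
  by rewrite -val_eqE /= => /negPf ->; rewrite mul0r.
have : x \in I by rewrite IP; exact/asboolP.
rewrite Is => /asboolP[c ->].
elim/big_ind: _ => [|y z|i _]; [by case: QI|exact: is_idealD|].
by apply: is_idealM => //; apply: Qs; rewrite mem_nth.
Qed.

(** A family without maximal member would contain a strictly increasing
    sequence, whose union is finitely generated and hence equal to one of its
    terms. *)
Lemma noetherian_maximal (F : (R -> Prop) -> Prop) P0 :
    (forall P, F P -> is_ideal P) -> F P0 ->
  exists P, F P /\ forall Q, F Q -> (forall x, P x -> Q x) -> forall x, Q x -> P x.
Proof.
move=> Fid FP0; apply: contrapT => nomax.
have next (P : {P | F P}) : exists Q : {P | F P},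
    (forall x, sval P x -> sval Q x) /\ exists x, sval Q x /\ ~ sval P x.
  apply: contrapT => noQ; apply: nomax; exists (sval P).
  split=> [|Q FQ PQ x Qx]; first exact: svalP.
  by apply: contrapT => Px; apply: noQ; exists (exist _ Q FQ); split=> //; exists x.
have [f fP] := choice next.
pose C n := sval (iter n f (exist _ P0 FP0)).
have Cid n : is_ideal (C n) by exact/Fid/svalP.
have CS n x : C n x -> C n.+1 x by move=> Cx; exact: (fP _).1.
have Cle k n x : (k <= n)%N -> C k x -> C n x.
  by move=> /subnK <-; elim: (n - k)%N => // l IHl /IHl; exact: CS.
have [|s [sC Cs]] := @ideal_generators (fun x => exists n, C n x).
  split=> [|a x y [i xi] [j yj]]; first by exists 0%N; case: (Cid 0%N).
  exists (maxn i j); apply: (Cid _).2.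
    by apply: Cle xi; exact: leq_maxl.
  by apply: Cle yj; exact: leq_maxr.
have [N sN] : exists N, forall c, c \in s -> C N c.
  elim: s sC {Cs} => [|c s IHs] sC; first by exists 0%N.
  have [k ck] : exists n, C n c by apply: sC; rewrite inE eqxx.
  have [d ds|n sn] := IHs; first by apply: sC; rewrite inE ds orbT.
  exists (maxn k n) => d; rewrite inE => /predU1P[->|/sn].
    by apply: Cle ck; exact: leq_maxl.
  by apply: Cle; exact: leq_maxr.
have [_ [x [Cx]]] := fP (iter N f (exist _ P0 FP0)); apply.
by apply: (Cs _ (Cid N) sN); exists N.+1.
Qed.

End Ideals.

(** * Extension of linear maps into injective modules *)

(** A single-valued linear relation [G] between [N] and [E] is a linear map
    defined on a submodule of [N].  Relations make it possible to define maps on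
    images and quotients without forming these modules. *)
Section LinearRelation.
Variables (R : comNzRingType) (N E : lmodType R) (G : N -> E -> Prop).
Hypotheses (G0 : G 0 0)
  (GD : forall a x y u v, G x u -> G y v -> G (a *: x + y) (a *: u + v))
  (G_fun : forall u, G 0 u -> u = 0).

Let dom : {pred N} := fun x => `[< exists u, G x u >].

Let dom_closed : submod_closed dom.
Proof.
split=> [|a x y /asboolP[u xu] /asboolP[v yv]]; apply/asboolP; first by exists 0.
by exists (a *: u + v); exact: GD.
Qed.

HB.instance Definition _ := GRing.isSubmodClosed.Build R N dom dom_closed.

Let sub := {x : N | x \in dom}.
HB.instance Definition _ := SubChoice.on sub.
HB.instance Definition _ := [SubChoice_isSubLmodule of sub by <:].

Lemma injective_extension : injective_module E ->
  exists g : {linear N -> E}, forall x u, G x u -> g x = u.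
Proof.
move=> E_inj.
have G_eq x u v : G x u -> G x v -> u = v.
  move=> xu xv; apply/eqP; rewrite -subr_eq0; apply/eqP/G_fun.
  by have := GD (-1) xv xu; rewrite !scaleN1r addNr addrC.
have [f fP] : {f : sub -> E & forall x, G (val x) (f x)}.
  apply: (@choice sub E (fun x u => G (val x) u)) => -[x xd]; exact: asboolW xd.
have f_lin : linear f.
  move=> a x y; apply: G_eq (fP _) _.
  by rewrite linearP; apply: GD; exact: fP.
pose F : {linear sub -> E} := HB.pack f (GRing.isLinear.Build R sub E *:%R f f_lin).
have [g gP] := E_inj sub N (val : {linear sub -> N}) F val_inj.
exists g => x u xu.
have xd : x \in dom by apply/asboolP; exists u.
by rewrite -[x]/(val (exist _ x xd : sub)) gP; apply: G_eq (fP _) _.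
Qed.

End LinearRelation.

Section InjectiveModules.
Variables (R : comNzRingType) (E : lmodType R).
Hypothesis E_inj : injective_module E.

Lemma extend_cyclic (N : lmodType R) (x : N) (e : E) :
  (forall a, a *: x = 0 -> a *: e = 0) -> exists g : {linear N -> E}, g x = e.
Proof.
move=> xe; pose G (y : N) u := exists a : R, y = a *: x /\ u = a *: e.
have [||u [a [/esym /xe ae ->//]]|g gP] := @injective_extension R N E G _ _ _ E_inj.
- by exists 0; rewrite !scale0r.
- move=> a _ _ _ _ [b [-> ->]] [c [-> ->]]; exists (a * b + c).
  by rewrite !scalerDl !scalerA.
by exists g; apply: gP; exists 1; rewrite !scale1r.
Qed.

(** The map [R a + P -> E] sending [c a + d] to [c e], with [d] in [P], extends
    to [R]; the image of 1 is the wanted element.  With [P] the zero ideal this is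
    divisibility; with [e] nonzero it says that [E] detects whether [a] lies in
    [P]. *)
Lemma divide_mod_ideal (P : R -> Prop) (a : R) (e : E) :
    is_ideal P -> (forall c, P (c * a) -> c *: e = 0) ->
  exists2 u : E, (forall d, P d -> d *: u = 0) & a *: u = e.
Proof.
move=> PI Pe; have [P0 PD] := PI.
pose G (b : R^o) (u : E) := exists c : R, P (b - c * a) /\ u = c *: e.
have [||u [c [+ ->]]|g gP] := @injective_extension R R^o E G _ _ _ E_inj.
- by exists 0; rewrite mul0r subr0 scale0r.
- move=> b x y _ _ [c [xc ->]] [d [yd ->]]; exists (b * c + d).
  rewrite scalerDl scalerA; split=> //.
  suff -> : b *: x + y - (b * c + d) * a = b * (x - c * a) + (y - d * a) by exact: PD.
  by rewrite /GRing.scale /=; ring.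
- rewrite sub0r => /(is_idealM (-1) PI); rewrite mulrNN mul1r; exact: Pe.
exists (g 1) => [d Pd|]; rewrite -linearZ; apply: gP.
  by exists 0; rewrite mul0r subr0 scale0r /GRing.scale /= mulr1.
by exists 1; rewrite scale1r /GRing.scale /= mulr1 mul1r subrr.
Qed.

End InjectiveModules.

Lemma annihilator_is_ideal (R : comNzRingType) (V : lmodType R) (v : V) :
  is_ideal (fun a => a *: v = 0).
Proof.
by split=> [|a x y xv yv]; rewrite ?scale0r // scalerDl -scalerA xv yv scaler0 addr0.
Qed.

Lemma scale_swap (R : comNzRingType) (V : lmodType R) a b (v : V) :
  a *: (b *: v) = b *: (a *: v).
Proof. by rewrite !scalerA mulrC. Qed.

(** * The injective hull of R/p *)

Section CyclicHull.
Variables (R : comNzRingType) (p : idealr R) (E : lmodType R).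

(** What essentiality of [R/p -> E] says about the image [e1] of 1. *)
Definition hull_generator (e1 : E) :=
  (forall a, (a *: e1 == 0) = (a \in p)) /\
  forall e, e != 0 -> exists r b, b \notin p /\ r *: e = b *: e1.

Lemma injective_hull_generator : injective_hull (quot_module p) E ->
  exists e1, hull_generator e1.
Proof.
move=> [_ [i [i_inj i_ess]]]; pose q (a : R) : quot_module p := quot_pi p a.
have qE a : i (q a) = a *: i (q 1).
  rewrite -linearZ; congr (i _).
  by rewrite /q -[a in LHS]mulr1 rmorphM.
have q0 a : (i (q a) == 0) = (a \in p).
  have -> : (a \in p) = (q a == 0).
    by have := Quotient.idealrBE p a 0; rewrite subr0 => ->; rewrite rmorph0.
  apply/eqP/eqP => [iqa|->]; last exact: linear0.
  by apply: i_inj; rewrite iqa linear0.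
exists (i (q 1)); split=> [a|e e0]; first by rewrite -qE q0.
pose S : {pred E} := fun x => `[< exists r, x = r *: e >].
have SU : submod_closed S.
  split=> [|a x y /asboolP[b ->] /asboolP[c ->]]; apply/asboolP.
    by exists 0; rewrite scale0r.
  by exists (a * b + c); rewrite scalerDl scalerA.
pose U := HB.pack_for (submodClosed E) S (GRing.isSubmodClosed.Build R E S SU).
have [|y /asboolP[r yr] y0] := i_ess U.
  by exists e => //; apply/asboolP; exists 1; rewrite scale1r.
have [b yb] : exists b, y = q b.
  by exists (repr (y : {ideal_quot p})); rewrite /q /quot_pi /= reprK.
by exists r, b; rewrite -q0 -qE -yb.
Qed.

End CyclicHull.

Section PrimeHull.
Variables (R : comNzRingType) (p : idealr R) (E : lmodType R) (e1 : E).
Hypotheses (R_noeth : noetherian R)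
  (p_prime : forall a b, a * b \in p -> a \in p \/ b \in p)
  (E_inj : injective_module E) (e1_gen : hull_generator p e1).

Definition killed n (e : E) := forall a, a \in ideal_exp p n.+1 -> a *: e = 0.

Lemma notin_prodP s t : s \notin p -> t \notin p -> s * t \notin p.
Proof.
by move=> sp tp; apply/negP => /p_prime[] h; [move: sp|move: tp]; rewrite h.
Qed.

Lemma gen_neq0 : e1 != 0.
Proof. by rewrite -[e1]scale1r e1_gen.1 idealr1. Qed.

Lemma kill_gen a : a \in p -> a *: e1 = 0.
Proof. by rewrite -e1_gen.1 => /eqP. Qed.

(** A nonzero [e] killed by [s] would have a nonzero multiple in [R e1], which is
    a copy of the domain [R/p]. *)
Lemma hull_scale_inj s (e : E) : s \notin p -> s *: e = 0 -> e = 0.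
Proof.
move=> sp se; apply/eqP/negPn/negP => /e1_gen.2[r [b [bp re]]].
have : s * b \in p by rewrite -e1_gen.1 -scalerA -re scale_swap se scaler0.
by apply/negP; exact: notin_prodP.
Qed.

Lemma hull_scale_cancel s (e f : E) : s \notin p -> s *: e = s *: f -> e = f.
Proof.
move=> sp sef; apply/eqP; rewrite -subr_eq0; apply/eqP/(hull_scale_inj sp).
by rewrite scalerBr sef subrr.
Qed.

Lemma hull_divide s (e : E) : s \notin p -> exists f, s *: f = e.
Proof.
move=> sp; have [|c c0|f _ fe] := @divide_mod_ideal R E E_inj (fun a => a = 0) s e.
- by split=> // a x y -> ->; rewrite mulr0 addr0.
- by apply: (hull_scale_inj sp); rewrite scalerA mulrC c0 scale0r.
- by exists f.
Qed.

Lemma killed_le k n e : (k <= n)%N -> killed k e -> killed n e.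
Proof. by move=> kn ke a /(ideal_exp_le kn); exact: ke. Qed.

Lemma killed_cancel n s e : s \notin p -> killed n (s *: e) -> killed n e.
Proof.
move=> sp se a /se; rewrite scale_swap; exact: hull_scale_inj.
Qed.

Lemma killed0 e : killed 0 e <-> forall a, a \in p -> a *: e = 0.
Proof. by split=> h a; [rewrite -ideal_exp1|rewrite ideal_exp1]; exact: h. Qed.

Lemma killed_scale n a e : killed n e -> killed n (a *: e).
Proof. by move=> ne b bp; rewrite scale_swap ne ?scaler0. Qed.

Lemma killedS_scale n c e : c \in ideal_exp p n.+1 -> killed n.+1 e -> killed 0 (c *: e).
Proof.
move=> cp ne; apply/killed0 => a ap; rewrite scalerA; apply: ne.
by apply: (@ideal_exp_mul _ p 0 n) => //; rewrite ideal_exp1.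
Qed.

(** The socle of [E] over [R_p] is the residue field of [p]. *)
Lemma socle_gen e : killed 0 e -> exists s r, s \notin p /\ s *: e = r *: e1.
Proof.
move=> /killed0 pe; have [->|/e1_gen.2[r [b [bp re]]]] := eqVneq e 0.
  by exists 1, 0; rewrite idealr1 scaler0 scale0r.
exists r, b; split=> //; apply/negP => /pe; rewrite re => /eqP.
by rewrite e1_gen.1 (negPf bp).
Qed.

(** Among the elements that no power of [p] kills, take [f] with a largest
    annihilator.  Some [c] in [p] has [c f] again of this kind, for otherwise a
    power of [p] would kill all [c f] and hence [f]; so [c f] and [f] have the
    same annihilator.  But some multiple [r f] is a nonzero multiple of [e1], and
    then [r] kills [c f] and not [f]. *)
Lemma hull_torsion e : exists n, killed n e.
Proof.
apply: contrapT => e_bad; pose bad f := ~ exists n, killed n f.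
pose ann (f : E) := fun a : R => a *: f = 0.
have ann_ideal f : is_ideal (ann f) := annihilator_is_ideal f.
pose F P := exists2 f, bad f & P = ann f.
have [|| _ [[f f_bad ->] f_max]] := @noetherian_maximal R R_noeth F (ann e).
- by move=> _ [f _ ->].
- by exists e.
have [s [sp s_gen]] := ideal_generators R_noeth (idealr_is_ideal p).
have [c [cp c_bad]] : exists c, c \in p /\ bad (c *: f).
  apply: contrapT => c_ok; apply: f_bad.
  have [N sN] : exists N, forall c, c \in s -> killed N (c *: f).
    elim: s sp {s_gen} => [|c s IHs] sp; first by exists 0%N.
    have [n cn] : exists n, killed n (c *: f).
      by apply: contrapT => h; apply: c_ok; exists c; rewrite sp ?inE ?eqxx.
    have [d ds|N sN] := IHs; first by rewrite sp // inE ds orbT.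
    exists (maxn n N) => d; rewrite inE => /predU1P[->|/sN].
      by apply: killed_le cn; exact: leq_maxl.
    by apply: killed_le; exact: leq_maxr.
  exists N.+1 => a; apply: (@ideal_exp_ind R p 1 N.+1 (ann f)) => // x y.
  rewrite ideal_exp1 /ann => xp yp; rewrite mulrC -scalerA.
  apply: (s_gen (fun x => y *: (x *: f) = 0)) (xp) => [|c /sN]; last exact.
  split=> [|b u v uf vf]; first by rewrite scale0r scaler0.
  by rewrite scalerDl scalerDr -scalerA [y *: (b *: _)]scale_swap uf vf scaler0 addr0.
have f0 : f != 0.
  by apply/eqP => f0; apply: f_bad; exists 0%N => a _; rewrite f0 scaler0.
have [r [b [bp rf]]] := e1_gen.2 _ f0.
have : ann f r.
  apply: (f_max (ann (c *: f))) => [|x xf|]; first by exists (c *: f).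
    by rewrite /ann scale_swap xf scaler0.
  by rewrite /ann scale_swap rf scale_swap kill_gen ?scaler0.
by rewrite /ann rf => /eqP; rewrite e1_gen.1 (negPf bp).
Qed.

(** If no [t a] with [t] outside [p] lies in [p^(n+1)], then [c a] in [p^(n+1)]
    implies [c] in [p], so [e1] can be divided by [a] inside [E_n]. *)
Lemma annihilator_killed n a : (forall e, killed n e -> a *: e = 0) ->
  exists2 t, t \notin p & t * a \in ideal_exp p n.+1.
Proof.
move=> na; apply: contrapT => no_t.
have [||e ne ae] := @divide_mod_ideal R E E_inj (fun x => x \in ideal_exp p n.+1) a e1.
- exact: idealr_is_ideal.
- move=> c cp; apply/eqP; rewrite e1_gen.1; apply/negPn/negP => cnp.
  by apply: no_t; exists c.
- by have := gen_neq0; rewrite -ae na ?eqxx.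
Qed.

End PrimeHull.

(** * Maps from the hull into an injective module *)

Section Comparison.
Variables (R : comNzRingType) (p : idealr R) (E : lmodType R) (e1 : E).
Variables (E' : lmodType R) (phi : {linear E -> E'}).
Hypotheses (R_noeth : noetherian R)
  (p_prime : forall a b, a * b \in p -> a \in p \/ b \in p)
  (E_inj : injective_module E) (e1_gen : hull_generator p e1).

(** If [d] does not kill [E_n], then [d E_n] contains the whole socle, since
    every nonzero element of [E] has a multiple generating the socle over [R_p];
    this is impossible when [phi] vanishes on [d E_n] but not at [e']. *)
Lemma multiplier_faithful e' n d : killed p 0 e' -> phi e' != 0 ->
    (forall e, killed p n e -> phi (d *: e) = 0) ->
  exists2 t, t \notin p & t * d \in ideal_exp p n.+1.
Proof.
move=> e'0 phi_e' nd.
apply: (annihilator_killed E_inj e1_gen) => e ne; apply/eqP/negPn/negP.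
move=> /e1_gen.2[r [b [bp re]]].
have [s [a [sp se']]] := socle_gen e1_gen e'0.
have bsp := notin_prodP p_prime bp sp.
have [f fe] := hull_divide p_prime E_inj e1_gen ((a * r) *: e) bsp.
have fn : killed p n f.
  apply: (killed_cancel p_prime e1_gen bsp); rewrite fe; exact: killed_scale.
have df : d *: f = e'.
  apply: (hull_scale_cancel p_prime e1_gen bsp).
  rewrite scale_swap fe scale_swap -[_ *: (d *: e)]scalerA re -scalerA se' !scalerA.
  by congr (_ *: _); ring.
by move: phi_e'; rewrite -df nd ?eqxx.
Qed.

Hypotheses (E'_inj : injective_module E')
  (socle_multiplier : forall psi : {linear E -> E'},
     exists a s, s \notin p /\ forall e, killed p 0 e -> psi (s *: e) = phi (a *: e)).

(** Maps on [E_(n+1)] that only depend on the products [c e] for [c] in [s].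
    On the elements killed by the tail of [s], such a map factors through
    [e |-> c e], which has values in the socle, so subtracting a multiple of
    [phi] makes it vanish there and the list gets shorter. *)
Lemma multiplier_lift n (s : seq R) (psi : {linear E -> E'}) :
    (forall c, c \in s -> c \in ideal_exp p n.+1) ->
    (forall e, killed p n.+1 e -> (forall c, c \in s -> c *: e = 0) -> psi e = 0) ->
  exists a t, t \notin p /\
    forall e, killed p n.+1 e -> psi (t *: e) = phi (a *: e).
Proof.
elim: s psi => [|c s IHs] psi sp psi0.
  exists 0, 1; rewrite idealr1; split=> // e ne.
  by rewrite scale0r linear0 scale1r psi0.
have cp : c \in ideal_exp p n.+1 by apply: sp; rewrite inE eqxx.
pose V (e : E) := killed p n.+1 e /\ forall d, d \in s -> d *: e = 0.
have V0 : V 0 by split=> a _; rewrite scaler0.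
have VD a x y : V x -> V y -> V (a *: x + y).
  move=> [nx sx] [ny sy]; split=> d ds; rewrite scalerDr scale_swap.
    by rewrite nx ?ny ?scaler0 ?addr0.
  by rewrite sx ?sy ?scaler0 ?addr0.
have [|||g gP] := @injective_extension R E E'
    (fun y u => exists2 e, V e & y = c *: e /\ u = psi e) _ _ _ E'_inj.
- by exists 0 => //; rewrite scaler0 linear0.
- move=> a _ _ _ _ [x Vx [-> ->]] [y Vy [-> ->]]; exists (a *: x + y); first exact: VD.
  by rewrite linearP scalerDr !scalerA mulrC.
- move=> _ [e [ne se] [/esym ce ->]]; apply: psi0 => // d; rewrite inE.
  by move=> /predU1P[->|/se].
have {}gP e : V e -> g (c *: e) = psi e by move=> Ve; apply: gP; exists e.
have [a [t [tp gE]]] := socle_multiplier g.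
pose chi : {linear E -> E'} := (t \*: psi) \+ (\- ((a * c) \*: phi)).
have chiE e : chi e = t *: psi e - (a * c) *: phi e by [].
have [d ds|e ne se|a' [t' [t'p chiE']]] := IHs chi.
- by apply: sp; rewrite inE ds orbT.
- have gce := gE _ (killedS_scale cp ne).
  by rewrite chiE -gP // -[t *: _]linearZ gce scalerA linearZ subrr.
exists (a' + a * c * t'), (t' * t); split=> [|e ne]; first exact: notin_prodP.
rewrite scalerDl linearD -chiE' // chiE -[(a * c * t') *: e]scalerA.
by rewrite [phi ((a * c) *: _)]linearZ subrK -[t *: _]linearZ scalerA mulrC.
Qed.

Lemma multiplier_exists n (psi : {linear E -> E'}) : exists a s, s \notin p /\
  forall e, killed p n e -> psi (s *: e) = phi (a *: e).
Proof.
elim: n => [|n [a [s [sp psiE]]]]; first exact: socle_multiplier.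
pose chi : {linear E -> E'} := (s \*: psi) \+ (\- (a \*: phi)).
have chiE e : chi e = s *: psi e - a *: phi e by [].
have [gs [gs_in gs_gen]] :=
  ideal_generators R_noeth (idealr_is_ideal (ideal_exp p n.+1)).
have [e ne se|b [t [tp chiE']]] := @multiplier_lift n gs chi gs_in.
  rewrite chiE -[s *: _]linearZ psiE ?[phi _]linearZ ?subrr // => c cp.
  by apply: (gs_gen (fun x => x *: e = 0)) => //; exact: annihilator_is_ideal.
exists (b + a * t), (t * s); split=> [|e ne]; first exact: notin_prodP.
rewrite scalerDl linearD -chiE' // chiE -[(a * t) *: e]scalerA.
by rewrite [phi (a *: _)]linearZ subrK -[s *: _]linearZ scalerA mulrC.
Qed.

End Comparison.

(** * Local rings and the hull of the residue field *)

Section LocalRing.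
Variables (R : comNzRingType) (m : idealr R).
Hypotheses (R_noeth : noetherian R) (R_local : local_ring m).

Lemma proper_sub_maximal (P : R -> Prop) :
  is_ideal P -> ~ P 1 -> forall x, P x -> x \in m.
Proof.
move=> PI P1 x Px.
pose F (Q : R -> Prop) := [/\ is_ideal Q, ~ Q 1 & forall y, P y -> Q y].
have [||Q [[QI Q1 PQ] Qmax]] := @noetherian_maximal R R_noeth F P; first by move=> ? [].
  by split.
have [J JQ] := idealr_of QI Q1.
have Jmax : maximal_ideal J.
  move=> K JK y yK; rewrite JQ; apply/asboolP; apply: (Qmax (fun z => z \in K)) => //.
    split; [exact: idealr_is_ideal|by rewrite idealr1|].
    by move=> z /PQ Qz; apply: JK; rewrite JQ; exact/asboolP.
  by move=> z Qz; apply: JK; rewrite JQ; exact/asboolP.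
by rewrite -(R_local.2 J Jmax) JQ; exact/asboolP/PQ.
Qed.

Lemma notin_maximal_unit s : s \notin m -> exists t, t * s = 1.
Proof.
move=> sm; apply: contrapT => s_nunit; move/negP: sm; apply.
apply: (@proper_sub_maximal (fun x => exists t, x = t * s)) => [||].
- split=> [|a _ _ [t ->] [u ->]]; first by exists 0; rewrite mul0r.
  by exists (a * t + u); ring.
- by move=> [t e]; apply: s_nunit; exists t.
- by exists 1; rewrite mul1r.
Qed.

Lemma maximal_prime a b : a * b \in m -> a \in m \/ b \in m.
Proof.
move=> ab; have [|/notin_maximal_unit[t ta]] := boolP (a \in m); first by left.
by right; rewrite -[b]mul1r -ta -mulrA; exact: idealMr.
Qed.

Section ResidueFieldHull.
Variables (Ek : lmodType R) (k1 : Ek).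
Hypotheses (Ek_inj : injective_module Ek) (k1_gen : hull_generator m k1).

Lemma residue_socle e : killed m 0 e -> exists r, e = r *: k1.
Proof.
move=> /(socle_gen k1_gen)[s [r [/notin_maximal_unit[t ts] se]]].
by exists (t * r); rewrite -scalerA -se scalerA ts scale1r.
Qed.

Lemma gen_killed : killed m 0 k1.
Proof. by apply/killed0 => a; exact: kill_gen k1_gen _. Qed.

(** Multipliers of [psi] relative to the identity exist on each submodule killed
    by [m^(n+1)], and they are determined modulo [m^(n+1)], so they converge. *)
Lemma residue_hull_endo (psi : {linear Ek -> Ek}) : adic_complete m ->
  exists a, forall e, psi e = a *: e.
Proof.
move=> [back _ toK].
have socle (chi : {linear Ek -> Ek}) : exists a s, s \notin m /\
    forall e, killed m 0 e -> chi (s *: e) = idfun (a *: e).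
  have [a chi_k1] : exists a, chi k1 = a *: k1.
    apply: residue_socle => c cm; rewrite -linearZ (gen_killed cm); exact: linear0.
  exists a, 1; rewrite idealr1; split=> // e /residue_socle[r ->].
  by rewrite scale1r linearZ /= chi_k1 scale_swap.
have approx n : exists a, forall e, killed m n e -> psi e = a *: e.
  have [a [s [/notin_maximal_unit[t ts] psiE]]] :=
    @multiplier_exists R m Ek Ek idfun R_noeth maximal_prime Ek_inj socle n psi.
  exists (a * t) => e ne; rewrite -scalerA -[RHS]psiE; last exact: killed_scale.
  by rewrite scalerA mulrC ts scale1r.
have [a aP] := choice approx.
have a_close n : a n - a n.+1 \in ideal_exp m n.+1.
  have [e ne|t /notin_maximal_unit[u ut] ta] :=
    @annihilator_killed R m Ek k1 Ek_inj k1_gen n (a n - a n.+1).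
    have ne' : killed m n.+1 e by apply: killed_le ne.
    by rewrite scalerBl -aP // -aP // subrr.
  by rewrite -[_ - _]mul1r -ut -mulrA; exact: idealMr.
pose x : adic_prod m := fun n => \pi_{ideal_quot (ideal_exp m n.+1)} (a n).
have xP : x \in @adic_compat R m.
  apply/asboolP => n; exists (a n.+1); split=> //.
  by apply/eqP; have := a_close n; rewrite (Quotient.idealrBE (ideal_exp m n.+1)).
exists (back (exist _ x xP)) => e.
have [n ne] := hull_torsion R_noeth k1_gen e.
rewrite (aP n) //; apply/eqP; rewrite -subr_eq0 -scalerBl; apply/eqP/ne.
rewrite (Quotient.idealrBE (ideal_exp m n.+1)); apply/eqP.
have /(congr1 (fun y : adic_completion m => val y n)) := toK (exist _ x xP).
by move=> /esym.
Qed.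

End ResidueFieldHull.

(** * One-dimensional quotients *)

Section DimensionOne.
Variables (p : prime_idealr R).
Hypothesis p_dim : krull_dim {ideal_quot p} 1.

Lemma quotient_prime (P : R -> Prop) : is_ideal P -> ~ P 1 ->
    (forall a b, P (a * b) -> P a \/ P b) -> (forall a, a \in p -> P a) ->
  exists I : prime_idealr {ideal_quot p}, forall a, (\pi a \in I) = `[< P a >].
Proof.
move=> PI P1 PM pP; pose P' (z : {ideal_quot p}) := P (repr z).
have P'E a : P' (\pi a) <-> P a.
  have ap : repr (\pi_{ideal_quot p} a) - a \in p.
    by rewrite (Quotient.idealrBE p) reprK.
  rewrite /P'; set b := repr _ in ap *; split=> [Pb|Pa].
    have -> : a = (-1) * (b - a) + b by ring.
    by apply: PI.2 => //; exact: pP.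
  have -> : b = 1 * (b - a) + a by ring.
  by apply: PI.2 => //; exact: pP.
have [|||I IP] := @prime_idealr_of {ideal_quot p} P'.
- split; first by rewrite -(rmorph0 \pi) P'E; case: PI.
  move=> a x y; elim/quotW: a => a; elim/quotW: x => x; elim/quotW: y => y.
  by rewrite -rmorphM -rmorphD !P'E; exact: PI.2.
- by rewrite -(rmorph1 \pi) P'E.
- move=> a b; elim/quotW: a => a; elim/quotW: b => b.
  by rewrite -rmorphM !P'E; exact: PM.
by exists I => a; rewrite IP; apply/asboolP/asboolP; rewrite P'E.
Qed.

Lemma maximal_not_prime : exists x, x \in m /\ x \notin p.
Proof.
have [[P Pchain] _] := p_dim.
have [_ P10] := Pchain ord0 ord_max isT.
have [z [zP1 zP0]] : exists z, z \in P ord_max /\ z \notin P ord0.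
  apply: contrapT => h; apply: P10 => z zP1; apply/negPn/negP => zP0.
  by apply: h; exists z.
move: zP1 zP0; elim/quotW: z => x xP1 xP0; exists x; split.
  apply: (@proper_sub_maximal (fun a => \pi a \in P ord_max)) => //.
    split=> [|a u v uP vP]; first by rewrite rmorph0 idealr0.
    by rewrite rmorphD rmorphM rpredD ?idealMr.
  by rewrite rmorph1 idealr1.
apply: contra xP0 => xp.
suff -> : \pi_{ideal_quot p} x = 0 by rewrite idealr0.
by apply/eqP; rewrite -(rmorph0 \pi) -(Quotient.idealrBE p) subr0.
Qed.

(** An ideal [Q] that is maximal among those containing [p] and [x] but no power
    of [m] is prime: if [a] and [b] are not in [Q], then [Q + R a] and [Q + R b]
    contain powers of [m], hence so does their product, and the product is in [Q]
    if [a b] is.  Then [p], [Q] and [m] give a chain of length two in [R/p]. *)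
Lemma power_sub_ideal (J : R -> Prop) x : is_ideal J ->
    (forall a, a \in p -> J a) -> J x -> x \notin p ->
  exists c, forall a, a \in ideal_exp m c.+1 -> J a.
Proof.
move=> JI pJ Jx xp; apply: contrapT => no_c.
pose good (Q : R -> Prop) := exists c, forall a, a \in ideal_exp m c.+1 -> Q a.
pose F (Q : R -> Prop) := [/\ is_ideal Q, forall a, a \in p -> Q a, Q x & ~ good Q].
have [||Q [[QI pQ Qx Qbad] Qmax]] := @noetherian_maximal R R_noeth F J.
- by move=> ? [].
- by [].
have Q1 : ~ Q 1.
  by move=> Q1; apply: Qbad; exists 0%N => a _; rewrite -[a]mulr1; exact: is_idealM.
have sum_good a : ~ Q a -> good (fun y => exists b d, y = b * a + d /\ Q d).
  move=> Qa; apply: contrapT => a_bad; apply: Qa.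
  have [Q0 QD] := QI.
  apply: (Qmax (fun y => exists b d, y = b * a + d /\ Q d)) => [|y Qy|].
  - split=> //.
    + split=> [|c _ _ [b [d [-> Qd]]] [b' [d' [-> Qd']]]].
        by exists 0, 0; rewrite mul0r addr0.
      by exists (c * b + b'), (c * d + d'); split; [ring|exact: QD].
    + by move=> b bp; exists 0, b; rewrite mul0r add0r; split=> //; exact: pQ.
    + by exists 0, x; rewrite mul0r add0r.
  - by exists 0, y; rewrite mul0r add0r.
  - by exists 1, 0; rewrite mul1r addr0.
have QM a b : Q (a * b) -> Q a \/ Q b.
  move=> Qab; apply: contrapT => /not_orP[/sum_good[i ai] /sum_good[j bj]].
  apply: Qbad; exists (i + j.+1)%N => z.
  apply: (@ideal_exp_ind R m i.+1 j.+1 Q) => // u v /ai[c [d [-> Qd]]] /bj[c' [d' [-> Qd']]].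
  have -> : (c * a + d) * (c' * b + d') =
    (c * c') * (a * b) + ((c' * b + d') * d + (c * a) * d') by ring.
  by apply: QI.2 => //; apply: QI.2 => //; exact: is_idealM.
have pM a b : a * b \in p -> a \in p \/ b \in p.
  by rewrite prime_idealrM => /orP.
have p1 : ~ (1 \in p) by rewrite idealr1.
have m1 : ~ (1 \in m) by rewrite idealr1.
have [y [ym Qy]] : exists y, y \in m /\ ~ Q y.
  apply: contrapT => h; apply: Qbad; exists 0%N => a; rewrite ideal_exp1 => am.
  by apply: contrapT => Qa; apply: h; exists a.
have [I0 I0P] := quotient_prime (idealr_is_ideal p) p1 pM (fun a ap => ap).
have [I1 I1P] := quotient_prime QI Q1 QM pQ.
have [|I2 I2P] := quotient_prime (idealr_is_ideal m) m1 maximal_prime.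
  by move=> a /pQ; exact: proper_sub_maximal.
pose C (i : 'I_3) := nth I2 [:: I0; I1] i.
suff /p_dim.2 : prime_chain C by [].
have sub01 : {subset I0 <= I1}.
  by elim/quotW => a; rewrite I0P I1P => /asboolP /pQ ?; exact/asboolP.
have sub12 : {subset I1 <= I2}.
  elim/quotW => a; rewrite I1P I2P => /asboolP Qa.
  by apply/asboolP; exact: proper_sub_maximal Qa.
have ne01 : ~ {subset I1 <= I0}.
  move=> /(_ (\pi x)); rewrite I0P I1P => h; move/negP: xp; apply.
  by apply/asboolP/h/asboolP.
have ne12 : ~ {subset I2 <= I1}.
  by move=> /(_ (\pi y)); rewrite I1P I2P => h; apply: Qy; apply/asboolP/h/asboolP.
move=> [[|[|[|//]]] ?] [[|[|[|//]]] ?] //= _; split=> //.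
  by move=> z /sub01; exact: sub12.
by move=> h; apply: ne01 => z /sub12; exact: h.
Qed.

End DimensionOne.
End LocalRing.

(** * Ascending chains in the hull of the residue field *)

Section AscendingChains.
Variables (R : comNzRingType) (E : lmodType R).

Definition is_submod (M : E -> Prop) :=
  M 0 /\ forall (a : R) x y, M x -> M y -> M (a *: x + y).

(** The terms of the chain need not be contained in [V]; only their traces on [V]
    stabilize.  This makes the condition pass to smaller [V] without change. *)
Definition acc (V : E -> Prop) := forall M : nat -> E -> Prop,
  (forall n, is_submod (M n)) -> (forall n e, M n e -> M n.+1 e) ->
  exists N, forall k e, V e -> M k e -> M N e.

Lemma chain_le (M : nat -> E -> Prop) i j e :
  (forall n e, M n e -> M n.+1 e) -> (i <= j)%N -> M i e -> M j e.
Proof. by move=> MS /subnK <-; elim: (j - i)%N => // l IHl /IHl; exact: MS. Qed.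

Lemma acc_sub (V W : E -> Prop) : (forall e, V e -> W e) -> acc W -> acc V.
Proof.
move=> VW accW M Msub MS; have [N NP] := accW M Msub MS.
by exists N => k e /VW; exact: NP.
Qed.

Lemma acc_extension (V W : E -> Prop) c : is_submod V ->
    (forall e, V e -> W (c *: e)) ->
  acc (fun e => V e /\ c *: e = 0) -> acc W -> acc V.
Proof.
move=> [V0 VD] VW kerV accW M Msub MS; have [N1 N1P] := kerV M Msub MS.
have [||N2 N2P] := accW (fun n w => exists e, [/\ V e, M n e & w = c *: e]).
- move=> n; have [M0 MD] := Msub n; split=> [|a _ _ [e [Ve Me ->]] [f [Vf Mf ->]]].
    by exists 0; rewrite scaler0.
  by exists (a *: e + f); split; [exact: VD|exact: MD|rewrite scalerDr scale_swap].
- by move=> n _ [e [Ve /MS Me ->]]; exists e.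
exists (maxn N1 N2) => k e Ve Me.
have [f [Vf Mf cef]] : exists f, [/\ V f, M N2 f & c *: e = c *: f].
  by apply: (N2P k); [exact: VW|exists e].
have -> : e = ((-1) *: f + e) + f by rewrite scaleN1r addrC addrA addrN add0r.
have [M0 MD] := Msub (maxn N1 N2).
rewrite -[X in M _ (X + _)]scale1r; apply: MD; last first.
  by apply: chain_le Mf => //; exact: leq_maxr.
apply: chain_le (leq_maxl _ _) _ => //; apply: (N1P (maxn N2 k)).
  split; first exact: VD.
  by rewrite scalerDr scale_swap cef scaleN1r addNr.
apply: (Msub _).2.
  by apply: chain_le Mf => //; exact: leq_maxl.
by apply: chain_le Me => //; exact: leq_maxr.
Qed.

End AscendingChains.

Section ResidueFieldHullChains.
Variables (R : comNzRingType) (m : idealr R) (Ek : lmodType R) (k1 : Ek).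
Hypotheses (R_noeth : noetherian R) (R_local : local_ring m)
  (k1_gen : hull_generator m k1).

Lemma residue_socle_acc : acc (fun e : Ek => killed m 0 e).
Proof.
move=> M Msub MS; have [[k Mk]|noM] := pselect (exists k, M k k1).
  exists k => j e /(residue_socle R_noeth R_local k1_gen)[r ->] _.
  by rewrite -[_ *: _]addr0; apply: (Msub k).2 => //; exact: (Msub k).1.
exists 0%N => j e /(residue_socle R_noeth R_local k1_gen)[r ->] Mj.
have [rm|/(notin_maximal_unit R_noeth R_local)[t tr]] := boolP (r \in m).
  by rewrite (kill_gen k1_gen rm); exact: (Msub _).1.
case: noM; exists j; rewrite -[k1]scale1r -tr -scalerA -[_ *: _]addr0.
by apply: (Msub j).2 => //; exact: (Msub j).1.
Qed.

Lemma residue_hull_acc n : acc (fun e : Ek => killed m n e).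
Proof.
elim: n => [|n IHn]; first exact: residue_socle_acc.
have [gs [gs_in gs_gen]] :=
  ideal_generators R_noeth (idealr_is_ideal (ideal_exp m n.+1)).
have acc0 : acc (fun e : Ek => killed m n.+1 e /\ forall c, c \in gs -> c *: e = 0).
  apply: acc_sub IHn => e [_ gs_e] c cm.
  by apply: (gs_gen (fun x => x *: e = 0)) => //; exact: annihilator_is_ideal.
(* The conditions [c *: e = 0] are removed one generator at a time; the
   successive quotients embed into the socle through multiplication by [c]. *)
elim: gs gs_in acc0 {gs_gen} => [_|c gs IHgs gs_in acc0].
  by apply: acc_sub => e.
apply: IHgs => [d ds|]; first by apply: gs_in; rewrite inE ds orbT.
apply: (@acc_extension R Ek _ (fun e => killed m 0 e) c) => //.
- split=> [|a x y [nx sx] [ny sy]]; first by split=> a _; rewrite scaler0.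
  split=> d ds; rewrite scalerDr scale_swap.
    by rewrite nx ?ny ?scaler0 ?addr0.
  by rewrite sx ?sy ?scaler0 ?addr0.
- by move=> e [ne _]; apply: killedS_scale ne; apply: gs_in; rewrite inE eqxx.
- apply: acc_sub acc0 => e [[ne gs_e] ce]; split=> // d.
  by rewrite inE => /predU1P[->|/gs_e].
- exact: residue_socle_acc.
Qed.

End ResidueFieldHullChains.

(** * The canonical module of R/p has rank one *)

Section RankOne.
Variables (R : comNzRingType) (m : idealr R) (p : prime_idealr R).
Variables (Ek Ep : lmodType R) (k1 : Ek) (e1 : Ep) (phi : {linear Ep -> Ek}).
Hypotheses (R_noeth : noetherian R) (R_local : local_ring m)
  (R_complete : adic_complete m) (p_dim : krull_dim {ideal_quot p} 1)
  (Ek_inj : injective_module Ek) (k1_gen : hull_generator m k1)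
  (Ep_inj : injective_module Ep) (e1_gen : hull_generator p e1)
  (phi_e1 : phi e1 = k1).

Let p_prime a b : a * b \in p -> a \in p \/ b \in p.
Proof. by rewrite prime_idealrM => /orP. Qed.

Let k1_neq0 : k1 != 0 := gen_neq0 k1_gen.

(** If [f] is not in [phi(E_0)], there is an endomorphism of [Ek] that kills
    [phi(E_0)] and sends [f] to [k1].  It is the multiplication by some [a], and
    [a] is not in [p] since [a f] is nonzero.  So [a] is bijective on [E_0], and
    [phi(E_0) = a phi(E_0) = 0], against the choice of [phi]. *)
Lemma hull_map_socle_onto f : (forall a, a \in p -> a *: f = 0) ->
  exists2 e, killed p 0 e & phi e = f.
Proof.
move=> pf; apply: contrapT => no_e.
have [|||g gP] := @injective_extension R Ek Ek
    (fun y u => exists e r, [/\ killed p 0 e, y = phi e + r *: f & u = r *: k1])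
    _ _ _ Ek_inj.
- by exists 0, 0; rewrite linear0 !scale0r addr0; split=> // a _; rewrite scaler0.
- move=> a _ _ _ _ [e [r [e0 -> ->]]] [e' [r' [e'0 -> ->]]].
  exists (a *: e + e'), (a * r + r'); split.
  + by move=> b bp; rewrite scalerDr scale_swap e0 // e'0 // scaler0 addr0.
  + by rewrite linearP scalerDr scalerDl -scalerA addrACA.
  + by rewrite scalerDl scalerA.
- move=> u [e [r [e0 /esym erf ->]]]; apply/eqP; rewrite k1_gen.1; apply/negPn/negP.
  move=> /(notin_maximal_unit R_noeth R_local)[t tr]; apply: no_e.
  exists (- t *: e); first exact: killed_scale.
  apply/eqP; rewrite linearZ /= scaleNr -subr_eq0 -opprD oppr_eq0.
  by rewrite -[f]scale1r -tr -scalerA -scalerDr erf scaler0.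
have [a gE] := residue_hull_endo R_noeth R_local Ek_inj k1_gen g R_complete.
have gf : g f = k1.
  apply: gP; exists 0, 1; rewrite linear0 add0r !scale1r.
  by split=> // c _; rewrite scaler0.
have ap : a \notin p.
  by apply/negP => /pf af; move: k1_neq0; rewrite -gf gE af eqxx.
have [e ae] := hull_divide p_prime Ep_inj e1_gen e1 ap.
have e0 : killed p 0 e.
  by apply: (killed_cancel p_prime e1_gen ap); rewrite ae; exact: gen_killed e1_gen.
have : g (phi e) = 0.
  by apply: gP; exists e, 0; rewrite !scale0r addr0.
by rewrite gE -linearZ /= ae phi_e1 => /eqP; rewrite (negPf k1_neq0).
Qed.

Section Roots.
Variable x : R.
Hypotheses (xm : x \in m) (xp : x \notin p).

Lemma expr_in_ideal_exp n : x ^+ n.+1 \in ideal_exp m n.+1.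
Proof.
have := @ideal_exp_prod R m n.+1 (fun _ => x) (fun _ => xm).
by rewrite prodr_const card_ord.
Qed.

Lemma exprn_notin n : x ^+ n \notin p.
Proof.
elim: n => [|n IHn]; first by rewrite expr0 idealr1.
by rewrite exprS; exact: notin_prodP.
Qed.

Lemma is_ideal_add_principal (s : R) :
  is_ideal (fun y => exists b d, d \in p /\ y = b * s + d).
Proof.
split=> [|a _ _ [b [d [dp ->]]] [b' [d' [dp' ->]]]].
  by exists 0, 0; rewrite idealr0 mul0r addr0.
exists (a * b + b'), (a * d + d'); split; last by ring.
by rewrite rpredD // idealMr.
Qed.

(** Modulo [p], every [s] outside [p] divides a power of each element of [m]; in
    particular inverting one [x] in [m] outside [p] inverts them all. *)
Lemma power_mod_prime s : s \notin p ->
  exists c, forall a, a \in ideal_exp m c.+1 -> exists b d, d \in p /\ a = b * s + d.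
Proof.
move=> sp.
apply: (power_sub_ideal R_noeth R_local p_dim (is_ideal_add_principal s) _ _ sp) => [a ap|].
  by exists 0, a; rewrite mul0r add0r.
by exists 1, 0; rewrite idealr0 mul1r addr0.
Qed.

Variable u : nat -> Ep.
Hypothesis uE : forall n, x ^+ n *: u n = e1.

Lemma u_killed n : killed p 0 (u n).
Proof.
apply: (killed_cancel p_prime e1_gen (exprn_notin n)); rewrite uE.
exact: gen_killed e1_gen.
Qed.

Lemma u_step n : x *: u n.+1 = u n.
Proof.
apply: (hull_scale_cancel p_prime e1_gen (exprn_notin n)).
by rewrite uE scalerA -exprSr uE.
Qed.

Lemma socle_u e : killed p 0 e -> exists n a, e = a *: u n.
Proof.
move=> e0; have [s [r [sp se]]] := socle_gen e1_gen e0.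
have [c cP] := power_mod_prime sp; have [b [d [dp xE]]] := cP _ (expr_in_ideal_exp c).
exists c.+1, (b * r); apply: (hull_scale_cancel p_prime e1_gen (exprn_notin c.+1)).
rewrite scale_swap uE xE scalerDl -scalerA se scalerA.
by have /killed0 -> := e0; rewrite ?addr0.
Qed.

(** If [a] is not in [x R + p], the hull [Ek] has an element [f] killed by [p] and
    [x] with [a f] nonzero.  All such [f] are multiples of one [phi(u_N)] by the
    chain condition, so [a phi(u_N)] is nonzero. *)
Lemma annihilator_u_sub : exists N, forall a, phi (a *: u N) = 0 ->
  exists b d, d \in p /\ a = b * x + d.
Proof.
have [c cP] := power_mod_prime xp.
have [||N NP] := @residue_hull_acc R m Ek k1 R_noeth R_local k1_gen
    c (fun n f => exists r, f = r *: phi (u n)).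
- move=> n; split=> [|a _ _ [r ->] [s ->]]; first by exists 0; rewrite scale0r.
  by exists (a * r + s); rewrite scalerDl scalerA.
- by move=> n _ [r ->]; exists (r * x); rewrite -u_step linearZ scalerA.
exists N => a phi_a; apply: contrapT => a_bad.
have [b|f f_ann af] := divide_mod_ideal Ek_inj (a := a) (e := k1) (is_ideal_add_principal x).
  move=> [d [h [hp bE]]]; apply/eqP; rewrite k1_gen.1; apply/negPn/negP.
  move=> /(notin_maximal_unit R_noeth R_local)[t tb]; apply: a_bad.
  exists (t * d), (t * h); rewrite idealMr //; split=> //.
  by rewrite -[a]mul1r -tb -mulrA bE; ring.
have pf d : d \in p -> d *: f = 0.
  by move=> dp; apply: f_ann; exists 0, d; rewrite mul0r add0r.
have f_killed : killed m c f by move=> b /cP; exact: f_ann.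
have [e e0 ef] := hull_map_socle_onto pf.
have [n [b eE]] := socle_u e0.
have [r fE] : exists r, f = r *: phi (u N).
  by apply: (NP n) => //; exists b; rewrite -linearZ -eE.
by move: k1_neq0; rewrite -af fE scale_swap -[a *: _]linearZ phi_a scaler0 eqxx.
Qed.

(** Let [phi e = 0] and [x^(n+1) e = a u_N].  Then [phi(a u_N) = 0], so [a] is in
    [x R + p] and one factor [x] can be cancelled on both sides.  Repeating this
    gives [e] in [R u_N]. *)
Lemma kernel_bounded : exists N, forall e, killed p 0 e -> phi e = 0 ->
  exists b, x ^+ N *: e = b *: e1.
Proof.
have [N NP] := annihilator_u_sub; exists N => e e0 phi_e.
have [n [b eE]] := socle_u e0.
have : exists b, x ^+ (N + n) *: e = b *: e1.
  by exists (x ^+ N * b); rewrite eE scale_swap exprD -scalerA uE scalerA mulrC.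
elim: n {b eE} => [|n IHn] [a xe]; first by exists a; rewrite -xe addn0.
apply: IHn; have {}xe : x ^+ n.+1 *: e = a *: u N.
  apply: (hull_scale_cancel p_prime e1_gen (exprn_notin N)).
  by rewrite scalerA -exprD xe -(uE N) scale_swap.
have [|b [d [dp aE]]] := NP a; first by rewrite -xe linearZ /= phi_e scaler0.
exists b; rewrite exprD -scalerA -(uE N) -[RHS]scale_swap; congr (_ *: _).
apply: (hull_scale_cancel p_prime e1_gen xp).
rewrite scalerA -exprS xe aE scalerDl -scalerA scale_swap.
have /killed0 uN := u_killed N; by rewrite (uN d dp) addr0.
Qed.

(** On the kernel of [phi], [x^N e = b e1] gives
    [x^(M+1+N) psi e = b x^(M+1) psi e1 = 0].  So [x^(M+1+N) psi] factors through
    [phi], by an endomorphism of [Ek]. *)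
Lemma socle_multiplier_of_roots (psi : {linear Ep -> Ek}) : exists a s, s \notin p /\
  forall e, killed p 0 e -> psi (s *: e) = phi (a *: e).
Proof.
have [N NP] := kernel_bounded.
have [M psi_e1] := hull_torsion R_noeth k1_gen (psi e1).
pose s := x ^+ (M.+1 + N).
have ker e : killed p 0 e -> phi e = 0 -> psi (s *: e) = 0.
  move=> e0 /(NP _ e0)[b xe]; rewrite /s exprD -scalerA xe scale_swap !linearZ /=.
  by rewrite (psi_e1 _ (expr_in_ideal_exp M)) scaler0.
have [|||g gP] := @injective_extension R Ek Ek
    (fun y v => exists e, [/\ killed p 0 e, y = phi e & v = psi (s *: e)])
    _ _ _ Ek_inj.
- by exists 0; rewrite scaler0 !linear0; split=> // a _; rewrite scaler0.
- move=> a _ _ _ _ [e [e0 -> ->]] [f [f0 -> ->]]; exists (a *: e + f); split.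
  + by move=> b bp; rewrite scalerDr scale_swap e0 // f0 // scaler0 addr0.
  + by rewrite linearP.
  + by rewrite scalerDr scale_swap linearP.
- by move=> v [e [e0 /esym phi_e ->]]; exact: ker.
have [a gE] := residue_hull_endo R_noeth R_local Ek_inj k1_gen g R_complete.
exists a, s; split=> [|e e0]; first exact: exprn_notin.
have <- : g (phi e) = psi (s *: e) by apply: gP; exists e.
by rewrite gE linearZ.
Qed.

End Roots.

Lemma socle_multiplier (psi : {linear Ep -> Ek}) : exists a s, s \notin p /\
  forall e, killed p 0 e -> psi (s *: e) = phi (a *: e).
Proof.
have [x [xm xp]] := maximal_not_prime R_noeth R_local p_dim.
have [u uE] : {u : nat -> Ep & forall n, x ^+ n *: u n = e1}.
  apply: (@choice nat Ep (fun n v => x ^+ n *: v = e1)) => n.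
  by apply: (hull_divide p_prime Ep_inj e1_gen); exact: exprn_notin xp n.
exact: (socle_multiplier_of_roots xm xp uE).
Qed.

End RankOne.

(** * Fractions representing an element of the completed localization *)

Section LocalizationPowers.
Variables (R : comNzRingType) (p : prime_idealr R).

Lemma loc_frac_mul a s (sp : s \notin p) b t (tp : t \notin p) :
  loc_frac a sp * loc_frac b tp = loc_frac (a * b) (notin_mul sp tp).
Proof. exact: loc_mulE. Qed.

Lemma loc_frac_add a s (sp : s \notin p) b t (tp : t \notin p) :
  loc_frac a sp + loc_frac b tp = loc_frac (a * t + b * s) (notin_mul sp tp).
Proof. exact: loc_addE. Qed.

Lemma loc_frac_opp a s (sp : s \notin p) : - loc_frac a sp = loc_frac (- a) sp.
Proof. exact: loc_oppE. Qed.

Lemma loc_frac_sub a s (sp : s \notin p) b t (tp : t \notin p) :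
  loc_frac a sp - loc_frac b tp = loc_frac (a * t - b * s) (notin_mul sp tp).
Proof. by rewrite loc_frac_opp loc_frac_add mulNr. Qed.

Lemma loc_max_exp_frac n z : z \in ideal_exp (@loc_max R p) n.+1 ->
  exists a s (sp : s \notin p), a \in ideal_exp p n.+1 /\ z = loc_frac a sp.
Proof.
pose Q k (z : localization p) :=
  exists a s (sp : s \notin p), a \in ideal_exp p k.+1 /\ z = loc_frac a sp.
have Q_ideal k : is_ideal (Q k).
  split; first by exists 0, 1, (notin_one p); rewrite idealr0.
  move=> w _ _ [b [t [tp [bp ->]]]] [c [v [vp [cp ->]]]].
  have [a [s [sp ->]]] := loc_fracP w.
  exists (a * b * v + c * (s * t)), (s * t * v), (notin_mul (notin_mul sp tp) vp).
  rewrite loc_frac_mul loc_frac_add; split=> //.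
  have -> : a * b * v + c * (s * t) = (a * v) * b + (s * t) * c by ring.
  by rewrite rpredD // idealMr.
elim: n z => [|n IHn] z; first by rewrite ideal_exp1 => /asboolP[a [s [sp [ap ->]]]];
  exists a, s, sp; rewrite ideal_exp1.
apply: (@ideal_exp_ind _ (@loc_max R p) 1 n.+1 (Q n.+1)) => // x y.
rewrite ideal_exp1 => /asboolP[a [s [sp [ap ->]]]] /IHn[b [t [tp [bp ->]]]].
exists (a * b), (s * t), (notin_mul sp tp); rewrite loc_frac_mul; split=> //.
by apply: (@ideal_exp_mul _ p 0 n); rewrite ?ideal_exp1.
Qed.

Lemma mem_loc_max_exp n a s (sp : s \notin p) :
  loc_frac a sp \in ideal_exp (@loc_max R p) n.+1 <->
  exists2 t, t \notin p & t * a \in ideal_exp p n.+1.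
Proof.
split=> [/loc_max_exp_frac[b [t [tp [bp /loc_frac_eqP[u up e]]]]]|[t tp tap]].
  exists (u * t); first exact: notin_mul.
  have -> : u * t * a = u * (a * t) by ring.
  by rewrite e [b * s]mulrC mulrA idealMr.
have -> : loc_frac a sp = loc_frac 1 (notin_mul sp tp) * to_loc p (t * a).
  rewrite /to_loc loc_frac_mul; apply/loc_frac_eqP.
  by exists 1; [exact: notin_one|ring].
apply: idealMr; move: tap => /asboolP[k [c [cp ->]]].
apply/asboolP; exists k, (fun i j => to_loc p (c i j)); split=> [i j|].
  by apply/asboolP; exists (c i j), 1, (notin_one p).
by rewrite rmorph_sum; apply: eq_bigr => i _; rewrite rmorph_prod.
Qed.

Implicit Types x y : loc_completion p.

(** The fraction [a/s] approximates [x] modulo the power [n+1] of the maximal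
    ideal. *)
Definition represents x n a s := exists sp : s \notin p,
  val x n = \pi_{ideal_quot (ideal_exp (@loc_max R p) n.+1)} (loc_frac a sp).

Lemma represents_exists x n : exists a s, s \notin p /\ represents x n a s.
Proof.
have [a [s [sp e]]] := loc_fracP (repr (val x n)).
by exists a, s; split=> //; exists sp; rewrite -e reprK.
Qed.

Lemma represents_notin x n a s : represents x n a s -> s \notin p.
Proof. by case. Qed.

Lemma represents_eq x y n a s b t : represents x n a s -> represents y n b t ->
  val x n = val y n <-> exists2 v, v \notin p & v * (a * t - b * s) \in ideal_exp p n.+1.
Proof.
move=> [sp ->] [tp ->]; rewrite -(mem_loc_max_exp n _ (notin_mul sp tp)) -loc_frac_sub.
by rewrite (Quotient.idealrBE (ideal_exp (@loc_max R p) n.+1)); split=> /eqP.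
Qed.

Lemma represents_le x k n a s : (k <= n)%N -> represents x n a s -> represents x k a s.
Proof.
move=> /subnK <-; elim: (n - k)%N => // l IHl; rewrite addSn => -[sp xE].
apply: IHl; exists sp.
have /asboolP/(_ (l + k)%N)[q [-> xq]] := valP x.
apply/eqP; rewrite -(Quotient.idealrBE (ideal_exp (@loc_max R p) (l + k).+1)).
apply: ideal_expS_le; rewrite (Quotient.idealrBE (ideal_exp (@loc_max R p) (l + k).+2)).
by apply/eqP; rewrite -xE -xq.
Qed.

Lemma represents_linear (c : R) x y n a s b t :
  represents x n a s -> represents y n b t ->
  represents (to_loc_completion p c * x + y) n (c * a * t + b * s) (s * t).
Proof.
move=> [sp xE] [tp yE]; exists (notin_mul sp tp).
change (\pi_{ideal_quot (ideal_exp (@loc_max R p) n.+1)} (to_loc p c) * val x n + val y n =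
  \pi_{ideal_quot (ideal_exp (@loc_max R p) n.+1)}
     (loc_frac (c * a * t + b * s) (notin_mul sp tp))).
rewrite xE yE -rmorphM -rmorphD; congr (\pi _).
rewrite /to_loc loc_frac_mul loc_frac_add; apply/loc_frac_eqP.
by exists 1; [exact: notin_one|ring].
Qed.

End LocalizationPowers.

(** * The dual of the hull *)

Section CompletedAction.
Variables (R : comNzRingType) (p : prime_idealr R) (E E' : lmodType R) (e1 : E).
Variables (phi : {linear E -> E'}).
Hypotheses (R_noeth : noetherian R) (E_inj : injective_module E)
  (e1_gen : hull_generator p e1).

Implicit Types x y : loc_completion p.

Let p_prime a b : a * b \in p -> a \in p \/ b \in p.
Proof. by rewrite prime_idealrM => /orP. Qed.

(** The graph of the action of the completion on [E]: [f = x e].  On [E_n] any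
    fraction approximating [x] to order [n+1] gives the action. *)
Definition acts x (e f : E) := exists n a s,
  [/\ killed p n e, represents x n a s & s *: f = a *: e].

Lemma acts_total x e : exists f, acts x e f.
Proof.
have [n ne] := hull_torsion R_noeth e1_gen e.
have [a [s [sp xE]]] := represents_exists x n.
have [f fE] := hull_divide p_prime E_inj e1_gen (a *: e) sp.
by exists f, n, a, s.
Qed.

Lemma acts_fun x e f g : acts x e f -> acts x e g -> f = g.
Proof.
move=> [k [a [s [ke xa sf]]]] [n [b [t [ne xb tg]]]].
have [le] : exists l, [/\ killed p l e, represents x l a s & represents x l b t].
  case: (leqP k n) => kn; [exists k|exists n]; split=> //.
    exact: represents_le xb.
  by apply: represents_le xa; exact: ltnW.
move=> [{}ke {}xa {}xb].
have [v vp vE] := (represents_eq xa xb).1 erefl.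
have [sp tp] := (represents_notin xa, represents_notin xb).
apply: (hull_scale_cancel p_prime e1_gen (notin_mul vp (notin_mul sp tp))).
apply/eqP; rewrite -subr_eq0; apply/eqP.
transitivity (v *: (t *: (s *: f) - s *: (t *: g))).
  by rewrite scalerBr !scalerA; congr (_ *: _ - _ *: _); ring.
rewrite sf tg; transitivity ((v * (a * t - b * s)) *: e); last exact: ke.
by rewrite !scalerA -scalerBl scalerA; congr (_ *: _); ring.
Qed.

Lemma acts_represents x e f n a s : acts x e f -> killed p n e ->
  represents x n a s -> s *: f = a *: e.
Proof.
move=> xf ne xa.
have [g gE] := hull_divide p_prime E_inj e1_gen (a *: e) (represents_notin xa).
by rewrite (acts_fun xf (_ : acts x e g)) //; exists n, a, s.
Qed.

Lemma acts_linear_r x (c : R) e f e' f' : acts x e f -> acts x e' f' ->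
  acts x (c *: e + e') (c *: f + f').
Proof.
move=> xf xf'.
have [[i ie] [j je]] := (hull_torsion R_noeth e1_gen e, hull_torsion R_noeth e1_gen e').
have {}ie : killed p (maxn i j) e by apply: killed_le ie; exact: leq_maxl.
have {}je : killed p (maxn i j) e' by apply: killed_le je; exact: leq_maxr.
have [a [s [sp xa]]] := represents_exists x (maxn i j).
exists (maxn i j), a, s; split=> //.
  by move=> b bp; rewrite scalerDr scale_swap ie // je // scaler0 addr0.
rewrite !scalerDr scale_swap [a *: (c *: e)]scale_swap.
by rewrite (acts_represents xf ie xa) (acts_represents xf' je xa).
Qed.

Lemma acts_linear_l (c : R) x y e f g : acts x e f -> acts y e g ->
  acts (to_loc_completion p c * x + y) e (c *: f + g).
Proof.
move=> xf yg; have [n ne] := hull_torsion R_noeth e1_gen e.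
have [a [s [sp xa]]] := represents_exists x n.
have [b [t [tp yb]]] := represents_exists y n.
exists n, (c * a * t + b * s), (s * t); split=> //; first exact: represents_linear.
have sf := acts_represents xf ne xa; have tg := acts_represents yg ne yb.
transitivity ((t * c) *: (s *: f) + s *: (t *: g)).
  by rewrite scalerDr !scalerA; congr (_ *: _ + _ *: _); ring.
by rewrite sf tg !scalerA -scalerDl; congr (_ *: _); ring.
Qed.

(** The relation [psi = phi o x], a correspondence between maps and elements of
    the completion that turns out to be a linear bijection. *)
Definition dual_to (psi : matlis_dual E' E) x := forall e f, acts x e f -> psi e = phi f.

Lemma dual_to_linear (c : R) psi chi x y : dual_to psi x -> dual_to chi y ->
  dual_to (c *: psi + chi) (to_loc_completion p c * x + y).
Proof.
move=> psix chiy e f ef; have [g eg] := acts_total x e; have [h eh] := acts_total y e.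
rewrite (acts_fun ef (acts_linear_l c eg eh)) linearP -(psix _ _ eg) -(chiy _ _ eh).
by [].
Qed.

Lemma dual_to_total_l x : exists psi, dual_to psi x.
Proof.
have [A AP] := choice (acts_total x).
have A_lin : linear A.
  by move=> c e f; apply: acts_fun (AP _) _; exact: acts_linear_r.
pose L : {linear E -> E} := HB.pack A (GRing.isLinear.Build R E E *:%R A A_lin).
exists (phi \o L : {linear E -> E'}) => e f ef /=.
by rewrite (acts_fun ef (AP e)).
Qed.

Lemma dual_to_fun_l psi chi x : dual_to psi x -> dual_to chi x -> psi = chi.
Proof.
move=> psix chix; apply: hom_ext => e; have [f ef] := acts_total x e.
by rewrite (psix _ _ ef) (chix _ _ ef).
Qed.

Hypotheses (phi_e1 : phi e1 != 0)
  (socle_multiplier : forall psi : {linear E -> E'},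
     exists a s, s \notin p /\ forall e, killed p 0 e -> psi (s *: e) = phi (a *: e))
  (E'_inj : injective_module E').

Let faithful n d : (forall e, killed p n e -> phi (d *: e) = 0) ->
  exists2 t, t \notin p & t * d \in ideal_exp p n.+1.
Proof.
apply: (multiplier_faithful p_prime E_inj e1_gen _ phi_e1).
by apply/killed0 => a; exact: kill_gen e1_gen _.
Qed.

(** If [a/s] and [b/t] approximate [x] and [y], then [phi] kills
    [(a t - b s) E_n]. *)
Lemma dual_to_fun_r psi x y : dual_to psi x -> dual_to psi y -> x = y.
Proof.
move=> psix psiy; apply: val_inj; apply: functional_extensionality_dep => n.
have [a [s [sp xa]]] := represents_exists x n.
have [b [t [tp yb]]] := represents_exists y n.
apply/(represents_eq xa yb); apply: faithful => e ne.
have ste : killed p n ((s * t) *: e) by exact: killed_scale.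
have xst : acts x ((s * t) *: e) ((a * t) *: e).
  by exists n, a, s; split=> //; rewrite !scalerA; congr (_ *: _); ring.
have yst : acts y ((s * t) *: e) ((b * s) *: e).
  by exists n, b, t; split=> //; rewrite !scalerA; congr (_ *: _); ring.
by rewrite scalerBl linearB -(psix _ _ xst) -(psiy _ _ yst) subrr.
Qed.

Lemma dual_to_total_r psi : exists x, dual_to psi x.
Proof.
have approx n : exists q : R * R, q.2 \notin p /\
    forall e, killed p n e -> psi (q.2 *: e) = phi (q.1 *: e).
  have [a [s [sp psiE]]] := multiplier_exists R_noeth p_prime E'_inj socle_multiplier n psi.
  by exists (a, s).
have [q qP] := choice approx.
pose z n := loc_frac (q n).1 (qP n).1.
pose x : adic_prod (@loc_max R p) :=
  fun n => \pi_{ideal_quot (ideal_exp (@loc_max R p) n.+1)} (z n).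
have xP : x \in @adic_compat _ (@loc_max R p).
  apply/asboolP => n; exists (z n.+1); split=> //.
  apply/eqP; rewrite -(Quotient.idealrBE (ideal_exp (@loc_max R p) n.+1)) loc_frac_sub.
  apply/mem_loc_max_exp; apply: faithful => e ne.
  have ne' : killed p n.+1 e by apply: killed_le ne.
  have [[qn qnE] [qn' qnE']] := (qP n, qP n.+1).
  rewrite scalerBl linearB -!scalerA -qnE; last exact: killed_scale.
  by rewrite -qnE'; [rewrite scale_swap subrr|exact: killed_scale].
exists (exist _ x xP) => e f ef; have [n ne] := hull_torsion R_noeth e1_gen e.
have xq : represents (exist _ x xP) n (q n).1 (q n).2 by exists (qP n).1.
have [qn qnE] := qP n.
have qf := acts_represents ef ne xq.
have [e' e'E] := hull_divide p_prime E_inj e1_gen e qn.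
rewrite -e'E qnE; last by apply: (killed_cancel p_prime e1_gen qn); rewrite e'E.
congr (phi _); apply: (hull_scale_cancel p_prime e1_gen qn).
by rewrite qf -e'E scale_swap.
Qed.

Lemma dual_completion :
  exists f : {linear matlis_dual E' E -> restrict_scalars (to_loc_completion p)},
    bijective f.
Proof.
have [f fP] := choice dual_to_total_r; have [g gP] := choice dual_to_total_l.
have f_lin : linear (f : matlis_dual E' E -> restrict_scalars (to_loc_completion p)).
  by move=> c psi chi; apply: dual_to_fun_r (fP _) _; exact: dual_to_linear.
pose F : {linear matlis_dual E' E -> restrict_scalars (to_loc_completion p)} :=
  HB.pack f (GRing.isLinear.Build R (matlis_dual E' E)
    (restrict_scalars (to_loc_completion p)) *:%R f f_lin).
exists F; exists g => [psi|x].
  exact: dual_to_fun_l (gP _) (fP _).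
exact: dual_to_fun_r (fP _) (gP _).
Qed.

End CompletedAction.

Theorem theorem1p2 (R : comNzRingType) (m : idealr R) (n : nat)
    (R_noeth : noetherian R) (R_local : local_ring m)
    (R_complete : adic_complete m)
    (R_CM : cohen_macaulay m) (R_dim : krull_dim R n)
    (p : prime_idealr R) (p_dim : krull_dim {ideal_quot p} 1)
    (Ek : lmodType R) (Ek_hull : injective_hull (quot_module m) Ek)
    (Ep : lmodType R) (Ep_hull : injective_hull (quot_module p) Ep) :
  exists f : {linear matlis_dual Ek Ep ->
              restrict_scalars (to_loc_completion p)},
    bijective f.
Proof.
have [k1 k1_gen] := injective_hull_generator Ek_hull.
have [e1 e1_gen] := injective_hull_generator Ep_hull.
have [[Ek_inj _] [Ep_inj _]] := (Ek_hull, Ep_hull).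
have [a ae1|phi phi_e1] := extend_cyclic Ek_inj (x := e1) (e := k1).
  apply/eqP; rewrite k1_gen.1.
  apply: (proper_sub_maximal R_noeth R_local (idealr_is_ideal p)).
    by rewrite idealr1.
  by rewrite -e1_gen.1 ae1.
apply: (dual_completion (phi := phi) R_noeth Ep_inj e1_gen _ _ Ek_inj).
  by rewrite phi_e1; exact: gen_neq0 k1_gen.
exact: (socle_multiplier R_noeth R_local R_complete p_dim Ek_inj k1_gen Ep_inj e1_gen).
Qed.
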